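(* Let $a,b$ be coprime positive integers and $d$ an integer with $1\le d<b-1$ and $d\mid(b-1)$. The map $S^d:(P,Q)\mapsto(S_P^d,S_Q^d)$ is a bijection from $NC_d(a,b)$ onto the set of good sequence pairs, and it commutes with rotation: $S^d(\mathrm{rot}(P,Q))=\mathrm{rot}(S^d(P,Q))$ for all $(P,Q)\in NC_d(a,b)$.
   Context: An $a,b$-Dyck path is a lattice path from $(0,0)$ to $(b,a)$ with unit north steps $N$ and east steps $E$ staying above the line $y=\frac{a}{b}x$; write it as $D=N^{v_0}EN^{v_1}E\cdots N^{v_{b-1}}E$, $v_i\ge 0$. A vertical run of length $v$ is a $P$-rise if $v>a/b$ and a $Q$-rise if $v<a/b$. For $1\le i\le b-1$ the label $i$ is the point $(i,v_0+\dots+v_{i-1})$. If $v_i>0$, the laser $\ell(i)$ is the segment of slope $a/b$ from label $i$ going northeast until it next meets $D$ (in the interior of an east step). $\ell(D)$ is the set of pairs $(i,j)$ with $\ell(i)$ ending on the east step whose west endpoint has $x$-coordinate $j$. The labeled pair $\pi(D)=(P,Q)$ of set partitions of $[b-1]$: $i,j$ in the same block of $P$ iff labels $i,j$ are not separated by any laser (label $k$ lies strictly below $\ell(k)$), and a block $B\in P$ gets rank $v_{\min(B)-1}$; $Q$ is the equivalence relation generated by $i\sim j$ whenever $\ell(i),\ell(j)$ end on the same east step immediately following a $Q$-rise, or $(i,j)\in\ell(D)$, or $(j,i)\in\ell(D)$, and a block $B\in Q$ gets rank $v_{\max(B)}$. $NC(a,b)=\{\pi(D)\}$ over all $a,b$-Dyck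 paths; $P$ and $Q$ are noncrossing. $\mathrm{rot}$ acts by $i\mapsto i+1$ ($b-1\mapsto1$) on all blocks of both partitions, ranks kept, and preserves $NC(a,b)$. $NC_d(a,b)$ is the set of $(P,Q)\in NC(a,b)$ with $\mathrm{rot}^d(P,Q)=(P,Q)$. For a $\mathrm{rot}^d$-invariant noncrossing partition of $[b-1]$, a block $B$ is central if $\mathrm{rot}^d(B)=B$, and wrapping if it is not central and every block in the $\langle\mathrm{rot}^d\rangle$-orbit of $B$ is contained in the interval $[\min B,\max B]$. For $(P,Q)\in NC_d(a,b)$ define $S_P^d=(p_1,\dots,p_d)$ and $S_Q^d=(q_1,\dots,q_d)$ by: $p_i=\mathrm{rank}_P(B)$ if $i=\min(B)$ for a noncentral, nonwrapping block $B\in P$, and $p_i=0$ otherwise; $q_i=\mathrm{rank}_Q(B)$ if $b-1-d+i=\max(B)$ for a noncentral, nonwrapping block $B\in Q$, and $q_i=0$ otherwise. A good sequence pair is a pair $((p_1,\dots,p_d),(q_1,\dots,q_d))$ of sequences of nonnegative integers with: $p_i=0$ or $p_i>a/b$ for each $i$; $q_i<a/b$ for each $i$; $\sum_{i=1}^d(p_i+q_i)\le ad/(b-1)$; and there is no $i\in[d]$ with both $p_{i+1}$ and $q_i$ nonzero (indices mod $d$). Rotation on sequence pairs is the cyclic shift $(s_1,\dots,s_d)\mapsto(s_d,s_1,\dots,s_{d-1})$ applied to both sequences. *)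

(* Defs.v *)
From mathcomp Require Import all_boot all_order all_algebra.
Set Implicit Arguments.
Unset Strict Implicit.
Unset Printing Implicit Defensive.
Import Order.TTheory GRing.Theory Num.Theory.
Local Open Scope ring_scope.

(* The label set [b-1] = {1, ..., b-1} is 'I_b.-1, the ordinal x standing for
   the label x + 1; in particular ordS is the cyclic map i |-> i + 1,
   b-1 |-> 1, on labels. *)
Notation label b := 'I_b.-1.

Definition lab b (x : label b) : nat := x.+1.

Definition slope (a b : nat) : rat := a%:R / b%:R.

(* The path N^{v_0} E N^{v_1} E ... N^{v_{b-1}} E is the sequence v of its
   vertical run lengths. *)
Definition run (v : seq nat) (i : nat) : nat := nth 0%N v i.

(* y-coordinate of the bottom of the vertical run at x = i; this is the
   lowest point of the path on the line x = i, and also the label i. *)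
Definition height (v : seq nat) (i : nat) : nat := sumn (take i v).

Definition dyck (a b : nat) (v : b.-tuple nat) : bool :=
  (sumn v == a) &&
  [forall i : 'I_b.+1, slope a b * i%:R <= (height v i)%:R].

Definition Qrise (a b : nat) (r : nat) : bool := r%:R < slope a b.

(* The y-coordinate at x of the line of slope a/b through the label i. *)
Definition laser_height (a b : nat) (v : seq nat) (i x : nat) : rat :=
  (height v i)%:R + slope a b * (x%:R - i%:R).

(* That line meets the interior of the east step whose endpoints are
   (j, height v j.+1) and (j.+1, height v j.+1). *)
Definition meets_step (a b : nat) (v : seq nat) (i j : nat) : bool :=
  laser_height a b v i j < (height v j.+1)%:R < laser_height a b v i j.+1.

(* (x, y) is in l(D): the laser fired from x ends on the east step with west
   abscissa y, i.e. this is the first step met by the laser. *)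
Definition laser (a b : nat) (v : seq nat) : rel (label b) := fun x y =>
  [&& (0 < run v (lab x))%N, (lab x <= lab y)%N,
      meets_step a b v (lab x) (lab y)
    & [forall z : label b, (lab x <= lab z < lab y)%N ==>
         ~~ meets_step a b v (lab x) (lab z)]].

(* The label z lies above the laser from x to the east step y.  The path stays
   above the laser between its two ends, the second of which has its abscissa
   strictly between y and y + 1, and the label x itself counts as below. *)
Definition above_laser b (x y z : label b) : bool :=
  (lab x < lab z <= lab y)%N.

Definition separated (a b : nat) (v : seq nat) : rel (label b) := fun z z' =>
  [exists x : label b, exists y : label b,
     laser a v x y && (above_laser x y z != above_laser x y z')].

Definition Ppart (a b : nat) (v : seq nat) : {set {set label b}} :=
  equivalence_partition (fun z z' => ~~ separated a v z z') [set: label b].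

Definition Qlink (a b : nat) (v : seq nat) : rel (label b) := fun x y =>
  [|| [exists z : label b,
         [&& laser a v x z, laser a v y z & Qrise a b (run v (lab z))]],
      laser a v x y | laser a v y x].

(* Qlink is symmetric, so connect, its reflexive transitive closure, is the
   equivalence relation it generates. *)
Definition Qpart (a b : nat) (v : seq nat) : {set {set label b}} :=
  equivalence_partition (connect (@Qlink a b v)) [set: label b].

Definition bmin b (B : {set label b}) : nat := \big[minn/b]_(x in B) lab x.
Definition bmax b (B : {set label b}) : nat := (\max_(x in B) lab x)%N.

(* A ranked family of blocks: R B is Some r if B is a block of rank r, and
   None if B is not a block. *)
Notation ranked b := {ffun {set label b} -> option nat}.

Definition mk_ranked b (P : {set {set label b}}) (r : {set label b} -> nat) :
  ranked b := [ffun B : {set label b} => if B \in P then Some (r B) else None].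

Definition pi_path (a b : nat) (v : b.-tuple nat) : ranked b * ranked b :=
  (mk_ranked (Ppart a b v) (fun B => run v (bmin B).-1),
   mk_ranked (Qpart a b v) (fun B => run v (bmax B))).

Definition NC (a b : nat) (PQ : ranked b * ranked b) : Prop :=
  exists2 v : b.-tuple nat, dyck a v & PQ = pi_path a v.

Definition rot_label b (x : label b) : label b := ordS x.

Definition rot_block b (B : {set label b}) : {set label b} :=
  [set rot_label x | x in B].

(* Contravariant on functions; see rot_rankedE. *)
Definition rot_ranked b (R : ranked b) : ranked b :=
  [ffun B : {set label b} => R (@rot_label b @^-1: B)].

Lemma rot_rankedE b (R : ranked b) (B : {set label b}) :
  rot_ranked R (rot_block B) = R B.
Proof.
rewrite ffunE; congr (R _); apply/setP=> x.
by rewrite inE mem_imset //; exact: ordS_inj.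
Qed.

Definition rot_pair b (PQ : ranked b * ranked b) : ranked b * ranked b :=
  (rot_ranked PQ.1, rot_ranked PQ.2).

Definition NCd (a b d : nat) (PQ : ranked b * ranked b) : Prop :=
  NC a PQ /\ iter d (@rot_pair b) PQ = PQ.

Definition rotd_block (b d : nat) (B : {set label b}) : {set label b} :=
  iter d (@rot_block b) B.

Definition central (b d : nat) (B : {set label b}) : bool := rotd_block d B == B.

Definition wrapping (b d : nat) (B : {set label b}) : bool :=
  ~~ central d B &&
  [forall C : {set label b}, (C \in orbit (@rotd_block b d) B) ==>
     (C \subset [set x | bmin B <= lab x <= bmax B]%N)].

(* The rank of a noncentral, nonwrapping block of R satisfying sel, and 0 if
   there is none.  Below, sel fixes the minimum or the maximum of the block, so
   at most one block of a partition qualifies. *)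
Definition rank_at (b d : nat) (R : ranked b) (sel : pred {set label b}) : nat :=
  if [pick B : {set label b} |
        [&& isSome (R B), sel B, ~~ central d B & ~~ wrapping d B]] is Some B
  then odflt 0%N (R B) else 0%N.

(* Sequences (s_1, ..., s_d): the ordinal i stands for the index i + 1. *)
Notation nseqs d := {ffun 'I_d -> nat}.

Definition S_P (b d : nat) (P : ranked b) : nseqs d :=
  [ffun i : 'I_d => rank_at d P (fun B => bmin B == i.+1)].

Definition S_Q (b d : nat) (Q : ranked b) : nseqs d :=
  [ffun i : 'I_d => rank_at d Q (fun B => bmax B == (b - 1 - d + i.+1)%N)].

Definition S_pair (b d : nat) (PQ : ranked b * ranked b) : nseqs d * nseqs d :=
  (S_P d PQ.1, S_Q d PQ.2).

Definition good_pair (a b d : nat) (s : nseqs d * nseqs d) : Prop :=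
  [/\ forall i, s.1 i = 0%N \/ slope a b < (s.1 i)%:R,
      forall i, (s.2 i)%:R < slope a b,
      ((\sum_(i < d) (s.1 i + s.2 i))%N)%:R <= (a * d)%:R / (b%:R - 1) :> rat
    & ~ exists i : 'I_d, s.1 (ordS i) <> 0%N /\ s.2 i <> 0%N].

(* (s_1, ..., s_d) |-> (s_d, s_1, ..., s_{d-1}) *)
Definition shift d (s : nseqs d) : nseqs d := [ffun i => s (ord_pred i)].

Definition shift_pair d (s : nseqs d * nseqs d) : nseqs d * nseqs d :=
  (shift s.1, shift s.2).

(* Main.v *)
(* Let h be the height of the path above the line y = (a/b)x.  The laser from i
   ends on the first step j with h(j+1) < h(i); hence the Q-block of i is the
   fibre of this j, the P-block of z is the fibre of the last x < z with
   h(x) < h(z), and both are determined by the relative order of the heights.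

   A rot^d-invariant pair has a central block; rotate the pair until that block
   is the P-block of 1 or the Q-block of b-1.  Then all other blocks lie between
   consecutive elements of the central one, and invariance says that the path is
   d-periodic except for one end entry, the rank of the central block.  The
   period w carries the same information as S^d, because w_i is a P-rank p_{i+1}
   if w_i > a/b and a Q-rank q_i if w_i < a/b, and the central rank is what is
   missing from a.  Conversely a period with small enough sum has, by the cycle
   lemma, a cyclic shift that is the period of a Dyck path; two such shifts
   correspond to two elements of the same central block, so they yield the same
   pair up to rotation. *)
Require Import Defs.
From mathcomp Require Import all_boot all_order all_algebra zify ring.
Import Order.TTheory GRing.Theory Num.Theory.
Set Implicit Arguments.
Unset Strict Implicit.
Unset Printing Implicit Defensive.

(** * Positive walks and their lasers *)

(** With n = b - 1, the heights above the diagonal are multiplied by b to become integers. The key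
    of a P-block is its least label minus 1, that of a Q-block its greatest label, so in both
    partitions the block with key k has rank v_k, and the one function [run v] gives both kinds of
    rank. Reading the heights backwards exchanges the two kinds of key, but reversed heights are in
    general not those of a path of the same shape; hence the facts about keys are proved for
    abstract walks.

    The divisibility gives 2d <= n. This is what turns noncentral and nonwrapping into span less
    than d, a condition on one block that does not mention its orbit.

    The constant ad/(b-1) arises because (b-1)/d periods have total at most a: the bound says that
    the missing rank r is nonnegative. By coprimality r is not a/b, and the side of a/b on which it
    lies decides whether the central block is in P or in Q. So the two kinds of central path never
    compete for the same sequence pair. *)

Definition walk (n : nat) (h : nat -> int) : Prop :=
  [/\ h 0 = 0%R, h n.+1 = 0%R, forall i, 0 < i <= n -> (0 < h i)%R
    & forall i j, i < j <= n -> h i <> h j].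

Definition last_below (h : nat -> int) (z : nat) : nat :=
  \max_(x < z | (h x < h z)%R) x.

(* The first j >= z with h j.+1 < h z, read off the reversed walk. *)
Definition laser_end (n : nat) (h : nat -> int) (z : nat) : nat :=
  n - last_below (fun i => h (n.+1 - i)) (n.+1 - z).

Lemma last_belowP n h z : walk n h -> 0 < z <= n ->
  [/\ last_below h z < z, (h (last_below h z) < h z)%R
    & forall y, last_below h z < y < z -> (h z < h y)%R].
Proof.
move=> [h0 _ hp hi] zn.
have z0 : 0 < z by lia.
(* The index 0 qualifies because h 0 = 0 < h z, so the maximum is attained. *)
have [x hx ex] : {x : 'I_z | (h x < h z)%R & last_below h z = x}.
  rewrite /last_below; apply: eq_bigmax_cond; apply/card_gt0P.
  by exists (Ordinal z0); rewrite unfold_in /= h0; apply: hp.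
rewrite ex; split=> // y /andP[xy yz].
have := hi y z; have : ~ (h y < h z)%R; last lia.
move=> hy; have : y <= last_below h z by apply: (leq_bigmax_cond (Ordinal yz)).
by rewrite ex; lia.
Qed.

Lemma last_below_eq n h z x : walk n h -> 0 < z <= n -> x < z -> (h x < h z)%R ->
  (forall y, x < y < z -> (h z < h y)%R) -> last_below h z = x.
Proof.
move=> hw zn xz hx hy; have [Mz hM My] := last_belowP hw zn.
case: (ltngtP (last_below h z) x) => // H.
- by have := My x; lia.
- by have := hy (last_below h z); lia.
Qed.

Lemma walk_rev n h : walk n h -> walk n (fun i => h (n.+1 - i)).
Proof.
move=> [h0 hn hp hi]; split; rewrite ?subn0 ?subnn //.
- by move=> i ?; apply: hp; lia.
- move=> i j ij; have [->|i0] := posnP i.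
    by rewrite subn0 hn; have := hp (n.+1 - j); lia.
  by have := hi (n.+1 - j) (n.+1 - i); lia.
Qed.

Lemma laser_endP n h z : walk n h -> 0 < z <= n ->
  [/\ z <= laser_end n h z <= n, (h (laser_end n h z).+1 < h z)%R
    & forall y, z < y <= laser_end n h z -> (h z < h y)%R].
Proof.
move=> hw zn; rewrite /laser_end; set k := fun i => _.
have zn' : 0 < n.+1 - z <= n by lia.
have [] := last_belowP (walk_rev hw) zn'; rewrite -/k;
  set m := last_below _ _ => mz km My.
have e1 : k m = h (n - m).+1 by rewrite /k; congr h; lia.
have e2 : k (n.+1 - z) = h z by rewrite /k; congr h; lia.
rewrite -e1 -e2; split; [lia|done|move=> y zy].
have := My (n.+1 - y).
by rewrite /k (_ : n.+1 - (n.+1 - y) = y); lia.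
Qed.

Lemma laser_end_eq n h z j : walk n h -> 0 < z <= n -> z <= j <= n ->
  (h j.+1 < h z)%R -> (forall y, z < y <= j -> (h z < h y)%R) -> laser_end n h z = j.
Proof.
move=> hw zn zj hj hy; have [Lz hL Ly] := laser_endP hw zn.
case: (ltngtP (laser_end n h z) j) => // H.
- by have := hy (laser_end n h z).+1; lia.
- by have := Ly j.+1; lia.
Qed.

Lemma laser_end_last n h : walk n h -> 0 < n -> laser_end n h n = n.
Proof. by move=> hw n0; have [] := @laser_endP n h n hw ltac:(lia); lia. Qed.

(** Every point after z up to the end of its laser is above z, and the next one is below. This makes
    the end the greatest label of its own Q-block. *)
Lemma laser_end_idem n h z : walk n h -> 0 < z <= n ->
  laser_end n h (laser_end n h z) = laser_end n h z.
Proof.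
move=> hw zn; have [Lz hL Ly] := laser_endP hw zn.
apply: laser_end_eq => //; [lia|lia| |by move=> y; lia].
have [e|zl] := eqVneq z (laser_end n h z); first by rewrite -{2}e.
by have := Ly (laser_end n h z); lia.
Qed.

Lemma last_below_succ n h z : walk n h -> 0 < z <= n ->
  last_below h (last_below h z).+1 = last_below h z.
Proof.
move=> hw zn; have [Mz hM My] := last_belowP hw zn.
apply: (@last_below_eq n) => //; [lia| |by move=> y; lia].
have [->|zl] := eqVneq (last_below h z).+1 z; first by [].
by have := My (last_below h z).+1; lia.
Qed.

(** Let p be the key of i and k, and q that of j and l. If p < q, then q lies between p and k, so h
    q > h k, while k lies between q and l, so h k > h l > h q. If q < p, the same contradiction
    arises from p between q and j, and j between p and k. *)
Lemma last_below_noncross n h i j k l : walk n h ->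
  0 < i -> i < j -> j < k -> k < l -> l <= n ->
  last_below h i = last_below h k -> last_below h j = last_below h l ->
    last_below h i = last_below h j.
Proof.
move=> hw i0 ij jk kl ln ik jl.
have [Mi hMi Myi] := @last_belowP n h i hw ltac:(lia).
have [Mj hMj Myj] := @last_belowP n h j hw ltac:(lia).
have [Mk hMk Myk] := @last_belowP n h k hw ltac:(lia).
have [Ml hMl Myl] := @last_belowP n h l hw ltac:(lia).
rewrite -ik in Mk hMk Myk; rewrite -jl in Ml hMl Myl.
have := Myk j; have := Myj (last_below h i).
case: (ltngtP (last_below h i) (last_below h j)) => // H; last by lia.
by have := Myl k; have := Myk (last_below h j); lia.
Qed.

Lemma laser_end_noncross n h i j k l : walk n h ->
  0 < i -> i < j -> j < k -> k < l -> l <= n ->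
  laser_end n h i = laser_end n h k -> laser_end n h j = laser_end n h l ->
    laser_end n h i = laser_end n h j.
Proof.
move=> hw i0 ij jk kl ln ik jl.
have sub z : 0 < z <= n ->
  last_below (fun i => h (n.+1 - i)) (n.+1 - z) = n - laser_end n h z.
  move=> zn; rewrite /laser_end.
  by have [] := @last_belowP n _ (n.+1 - z) (walk_rev hw) ltac:(lia); lia.
have [Li _ _] := @laser_endP n h i hw ltac:(lia).
have [Lj _ _] := @laser_endP n h j hw ltac:(lia).
have := @last_below_noncross n _ (n.+1 - l) (n.+1 - k) (n.+1 - j) (n.+1 - i)
  (walk_rev hw).
by rewrite !sub; lia.
Qed.

(** The definition of [laser_end] is one half of the duality; this is the other half, expressing
    P-keys by Q-keys of the reversed walk. *)
Lemma last_below_rev n h z : walk n h -> 0 < z <= n ->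
  last_below h z = n - laser_end n (fun i => h (n.+1 - i)) (n.+1 - z).
Proof.
move=> hw zn; have [Mz hM My] := last_belowP hw zn.
rewrite (@laser_end_eq _ _ _ (n - last_below h z) (walk_rev hw)); [lia|lia|lia| |].
- have -> : n.+1 - (n - last_below h z).+1 = last_below h z by lia.
  by have -> : n.+1 - (n.+1 - z) = z by lia.
- move=> y yy; have -> : n.+1 - (n.+1 - z) = z by lia.
  by apply: My; lia.
Qed.

(** * Periodic walks *)

Section Periodic.
Variables (n d : nat) (h : nat -> int) (D : int).
Hypotheses (hw : walk n h) (d0 : 0 < d) (dn : 2 * d <= n) (ddn : d %| n).
Hypothesis hD : forall i, i + d <= n -> h (i + d) = (h i + D)%R.

Lemma periodic_h i q : i + q * d <= n -> h (i + q * d) = (h i + q%:Z * D)%R.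
Proof.
elim: q => [|q IH]; first by rewrite mul0n addn0; lia.
by rewrite mulSn (addnC d) addnA => H; rewrite hD // IH; lia.
Qed.

Lemma periodic_last_below z q : 0 < z -> z + q * d <= n ->
  last_below h (z + q * d) = last_below h z + q * d.
Proof.
move=> z0 zq; have [Mz hM My] := @last_belowP n h z hw ltac:(lia).
apply: (last_below_eq hw); rewrite ?periodic_h; try lia.
move=> y yy; rewrite -(@subnK (q * d) y); last by lia.
by rewrite periodic_h; [have := My (y - q * d); lia|lia].
Qed.

(** The drift D equals h d > 0, since h 0 = 0. Writing j = s + 1 + q d with q >= 1 gives h j = h (s
    + 1) + q D > D. *)
Lemma periodic_h_d j : d < j <= n -> (h d < h j)%R.
Proof.
have [h0 _ hp _] := hw => dj.
have hd : h d = D by have := @hD 0; rewrite h0 add0n; lia.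
have D0 : (0 < D)%R by rewrite -hd; apply: hp; lia.
have := divn_eq j.-1 d; have := ltn_pmod j.-1 d0.
set q := j.-1 %/ d; set s := j.-1 %% d => sd e.
have -> : j = s.+1 + q * d by lia.
rewrite periodic_h ?hd; last by lia.
have q1 : 0 < q by case: (q) e => // ; lia.
have := hp s.+1 ltac:(lia).
suff : (D <= q%:Z * D)%R by lia.
by rewrite -{1}[D]mul1r ler_wpM2r ?ler_nat; lia.
Qed.

Lemma periodic_laser_end_d : laser_end n h d = n.
Proof.
have [_ hn hp _] := hw.
apply: (laser_end_eq hw); try lia; first by rewrite hn; apply: hp; lia.
exact: periodic_h_d.
Qed.

(** The point d is below all later ones up to n, so a laser from z <= d that gets as far as d is not
    stopped before n. *)
Lemma periodic_laser_end_lt z : 0 < z <= d -> laser_end n h z <> n ->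
  laser_end n h z < d.
Proof.
move=> zd Ln; have [Lz hL Ly] := @laser_endP n h z hw ltac:(lia).
case: ltnP => // dL; have := @periodic_h_d (laser_end n h z).+1 ltac:(lia).
by have [e|/eqP e] := eqVneq z d; [rewrite e in hL * |have := Ly d]; lia.
Qed.

Lemma periodic_laser_end z q : 0 < z <= d -> z + q * d <= n ->
  laser_end n h (z + q * d) = if laser_end n h z == n then
    n else laser_end n h z + q * d.
Proof.
move=> zd zq; have [Lz hL Ly] := @laser_endP n h z hw ltac:(lia).
have [_ hn hp _] := hw.
case: eqP => Ln.
  apply: (laser_end_eq hw); try lia; first by rewrite hn; apply: hp; lia.
  move=> y yy; rewrite -(@subnK (q * d) y); last by lia.
  by rewrite !periodic_h; [have := Ly (y - q * d); lia|lia|lia].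
have Ld := periodic_laser_end_lt zd Ln.
(* As d divides n, the period containing z + q d is complete. *)
have qd : q * d + d <= n.
  rewrite addnC -mulSn; have /dvdnP[k ek] := ddn.
  have : q < k by rewrite -(ltn_pmul2r d0) -ek; lia.
  by rewrite ek leq_pmul2r.
apply: (laser_end_eq hw); try lia.
  by rewrite -addSn !periodic_h; lia.
move=> y yy; rewrite -(@subnK (q * d) y); last by lia.
by rewrite !periodic_h; [have := Ly (y - q * d); lia|lia|lia].
Qed.
End Periodic.

(** * Rotation of a walk *)

Section RotWalk.
Variables (n : nat) (h h' : nat -> int).
Hypotheses (n0 : 0 < n) (hw : walk n h).
Let x := last_below h n.
Hypotheses (h'0 : h' 0 = 0%R)
  (h'l : forall i, i <= x -> h' i.+1 = (h i + h x.+1 - h x)%R)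
  (h'r : forall i, x < i <= n -> h' i.+1 = (h i - h n)%R).

(** Proved before [h'] is known to be a walk, because it serves to show that. The points up to x are
    raised by h (x + 1) - h x > 0, and those strictly between x and n were above h n. *)
Lemma rot_walk_gt0 i : 0 < i <= n -> (0 < h' i)%R.
Proof.
have [xn hx Mxy] := @last_belowP n h n hw ltac:(lia); rewrite -/x in xn hx Mxy.
case: hw => h0 hn hp _; case: i => // i ii.
have hx1 : (h x.+1 > h x)%R.
  by have [->|/eqP e] := eqVneq x.+1 n; [lia|have := Mxy x.+1; lia].
have [ix|xi] := leqP i x.
  by rewrite h'l //; have := hp i; case: (posnP i) => [->|]; rewrite ?h0; lia.
by rewrite h'r; [have := Mxy i; lia|lia].
Qed.

Hypothesis hw' : walk n h'.

(** Raising the points up to x and lowering the later ones by h n puts the former above every label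
    whose key was x; these labels now see only the origin below them. All other comparisons are
    within one side and are unchanged. *)
Lemma rot_last_below z : 0 < z < n ->
  last_below h' z.+1 = if last_below h z == x then 0 else (last_below h z).+1.
Proof.
move=> zn; have [xn hx Mxy] := @last_belowP n h n hw ltac:(lia);
  rewrite -/x in xn hx Mxy.
have [Mz hMz Mzy] := @last_belowP n h z hw ltac:(lia).
have hx1 : (h x.+1 > h x)%R.
  by have [->|/eqP e] := eqVneq x.+1 n; [lia|have := Mxy x.+1; lia].
have [h0 hn hp _] := hw; have [_ _ hp' _] := hw'.
have [zx|xz] := leqP z x.
  rewrite ifF; last by lia.
  apply: (last_below_eq hw'); rewrite ?h'l; try lia.
  by move=> [//|y] yy; rewrite h'l; [have := Mzy y; lia|lia].
have [zx|/eqP zx] := eqVneq (last_below h z) x.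
  apply: (last_below_eq hw'); rewrite ?h'0; try lia.
    by apply: hp'; lia.
  move=> [//|y] yy; rewrite [h' z.+1]h'r; last by lia.
  have hzx : (h z <= h x.+1)%R.
    by have [->|/eqP e] := eqVneq z x.+1; [lia|have := Mzy x.+1; lia].
  have [yx|xy] := leqP y x; last by rewrite h'r; [have := Mzy y; lia|lia].
  rewrite h'l //; have := hp y; case: (posnP y) => [->|]; rewrite ?h0; lia.
have xM : x < last_below h z by have := Mzy x; have := Mxy z; lia.
apply: (last_below_eq hw'); rewrite ?h'r; try lia.
by move=> [//|y] yy; rewrite h'r; [have := Mzy y; lia|lia].
Qed.

(** The label 1 is the image of n. For x > 0, x is the label preceding n in the Q-block of n, so x +
    1 becomes the greatest label of the rotated block. *)
Lemma rot_laser_end1 : laser_end n h' 1 = x.+1.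
Proof.
have [xn hx Mxy] := @last_belowP n h n hw ltac:(lia); rewrite -/x in xn hx Mxy.
have [h0 hn hp _] := hw.
apply: (laser_end_eq hw'); try lia.
  by rewrite h'r ?h'l ?h0; lia.
by move=> [//|y] yy; rewrite !h'l ?h0; have := hp y; lia.
Qed.

Lemma rot_laser_end z : 0 < z < n ->
  laser_end n h' z.+1 = if laser_end n h z == n then x.+1 else (laser_end n h z).+1.
Proof.
move=> zn; have [xn hx Mxy] := @last_belowP n h n hw ltac:(lia);
  rewrite -/x in xn hx Mxy.
have [Lz hLz Lzy] := @laser_endP n h z hw ltac:(lia).
have [h0 hn hp _] := hw.
have hx1 : (h x.+1 > h x)%R.
  by have [->|/eqP e] := eqVneq x.+1 n; [lia|have := Mxy x.+1; lia].
have [Ln|/eqP Ln] := eqVneq (laser_end n h z) n.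
  have zx : z <= x by have := Mxy z; have := Lzy n; lia.
  apply: (laser_end_eq hw'); try lia.
    by rewrite h'r ?h'l; have := hp z; lia.
  by move=> [//|y] yy; rewrite !h'l ?h0; have := Lzy y; lia.
have [zx|xz] := leqP z x; last first.
  apply: (laser_end_eq hw'); try lia.
    by rewrite !h'r; lia.
  by move=> [//|y] yy; rewrite !h'r; have := Lzy y; lia.
have Lzx : laser_end n h z < x.
  case: (ltnP (laser_end n h z) x) => // xL.
  have hzx : (h z <= h x)%R.
    by have [->|/eqP e] := eqVneq z x; [lia|have := Lzy x; lia].
  have := Mxy (laser_end n h z).+1.
  have [e|/eqP e] := eqVneq (laser_end n h z).+1 n; last by lia.
  by move: hLz; rewrite e; lia.
apply: (laser_end_eq hw'); try lia.
  by rewrite !h'l; lia.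
by move=> [//|y] yy; rewrite !h'l; have := Lzy y; lia.
Qed.

(** The path goes up from x to x + 1, so no laser ends there. Hence x + 1, the new key of the
    Q-block of n, collides with no shifted key. *)
Lemma rot_key_neq z : 0 < z <= n -> laser_end n h z <> x.
Proof.
move=> zn; have [xn hx Mxy] := @last_belowP n h n hw ltac:(lia);
  rewrite -/x in xn hx Mxy.
have [Lz hLz Lzy] := @laser_endP n h z hw ltac:(lia) => e; rewrite e in Lz hLz Lzy.
have hzx : (h z <= h x)%R.
  by have [->|/eqP e'] := eqVneq z x; [lia|have := Lzy x; lia].
have hx1 : (h x.+1 > h x)%R.
  by have [->|/eqP e'] := eqVneq x.+1 n; [lia|have := Mxy x.+1; lia].
lia.
Qed.
End RotWalk.

(** * Ranked partitions as fibres *)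

Section RankedFibres.
Variable n : nat.
Implicit Types (f : 'I_n -> nat) (g : nat -> nat).

Definition cls f (z : 'I_n) : {set 'I_n} := [set y | f y == f z].

(* The blocks are the fibres of f, and the fibre over k has rank g k. *)
Definition fib f g : ranked n.+1 :=
  [ffun B : {set 'I_n} =>
     if [pick z | B == cls f z] is Some z then Some (g (f z)) else None].

Lemma mem_cls f y z : (y \in cls f z) = (f y == f z).
Proof. by rewrite inE. Qed.

Lemma cls_self f z : z \in cls f z.
Proof. by rewrite mem_cls. Qed.

Lemma eq_cls f y z : (cls f y == cls f z) = (f y == f z).
Proof.
apply/eqP/eqP => [e|e]; first by apply/eqP; rewrite -mem_cls -e cls_self.
by apply/setP => t; rewrite !mem_cls e.
Qed.

Lemma fib_cls f g z : fib f g (cls f z) = Some (g (f z)).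
Proof.
rewrite ffunE; case: pickP => [t|/(_ z)]; last by rewrite eqxx.
by rewrite eq_cls => /eqP ->.
Qed.

Lemma fib_block f g B : isSome (fib f g B) -> exists z, B = cls f z.
Proof. by rewrite ffunE; case: pickP => // z /eqP -> _; exists z. Qed.

Lemma eq_fib f f' g g' : (forall z z', (f' z == f' z') = (f z == f z')) ->
  (forall z, g' (f' z) = g (f z)) -> fib f' g' = fib f g.
Proof.
move=> ef eg; apply/ffunP => B; rewrite !ffunE.
rewrite (eq_pick (_ : _ =1 [pred z | B == cls f z])).
  by case: pickP => // z _; rewrite eg.
by move=> z /=; congr (_ == _); apply/setP => y; rewrite !mem_cls.
Qed.

Lemma fib_inj f f' g g' : fib f' g' = fib f g ->
  (forall z z', (f' z == f' z') = (f z == f z'))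
  /\ (forall z, g' (f' z) = g (f z)).
Proof.
move=> e.
have c z : cls f' z = cls f z.
  have [t ct] : exists t, cls f' z = cls f t.
    by apply: (@fib_block _ g); rewrite -e fib_cls.
  by rewrite ct; apply/eqP; rewrite eq_cls eq_sym -mem_cls -ct cls_self.
split=> [z z'|z]; first by rewrite -!mem_cls c.
by have := fib_cls f' g' z; rewrite c e fib_cls => -[].
Qed.

Lemma mk_ranked_fib f g (r : {set 'I_n} -> nat) :
  (forall z, r (cls f z) = g (f z)) ->
  @mk_ranked n.+1 [set cls f z | z in setT] r = fib f g.
Proof.
move=> er; apply/ffunP => B; rewrite !ffunE; case: pickP => [z /eqP ->|nB].
  by rewrite imset_f // er.
by case: imsetP => // -[z _ e]; move: (nB z); rewrite e eqxx.
Qed.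

Definition rd t (z : 'I_n) : 'I_n := iter t (@ordS n) z.

Lemma rdS t z : rd t.+1 z = ordS (rd t z).
Proof. by []. Qed.

Lemma val_rd t z : rd t z = (z + t) %% n :> nat.
Proof.
elim: t z => [|t IH] z; first by rewrite addn0 modn_small.
by rewrite rdS /= IH -addn1 modnDml addn1 addnS.
Qed.

Lemma rd_add s t z : rd s (rd t z) = rd (s + t) z.
Proof. by rewrite /rd iterD. Qed.

Lemma val_rd_small t z : t <= n ->
  rd t z = (if z + t < n then z + t else z + t - n) :> nat.
Proof.
move=> tn; rewrite val_rd; case: ltnP => zt; first by rewrite modn_small.
rewrite -{1}(subnK zt) modnDr modn_small //.
by have := ltn_ord z; lia.
Qed.

Lemma rd_inj t : injective (rd t).
Proof. by elim: t => // t IH x y; rewrite !rdS => /ordS_inj /IH. Qed.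

Lemma rd_mod s t z : s = t %[mod n] -> rd s z = rd t z.
Proof. by move=> e; apply: val_inj; rewrite /= !val_rd -modnDmr e modnDmr. Qed.

Lemma rd_surj t z : exists y, z = rd t y.
Proof.
(* t n - t is a nonnegative representative of -t modulo n. *)
exists (rd (t * n - t) z); rewrite rd_add.
have n0 : 0 < n by case: (n) z => [[]//|].
have -> : t + (t * n - t) = t * n by rewrite subnKC // leq_pmulr.
by rewrite -[LHS]/(rd 0 z); apply: rd_mod; rewrite modnMl mod0n.
Qed.

(** Keys do not simply move along with their labels, so only the fibres and their ranks are
    compared. *)
Definition rotates f g f' g' t : Prop :=
  (forall z z', (f' (rd t z) == f' (rd t z')) = (f z == f z'))
  /\ (forall z, g' (f' (rd t z)) = g (f z)).

Lemma rot_fibE f g :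
  @rot_ranked n.+1 (fib f g) = fib (fun z => f (ord_pred z)) g.
Proof.
apply/ffunP => B; rewrite /rot_ranked ffunE [LHS]ffunE [RHS]ffunE.
set p := fun z => B == cls (fun z0 => f (ord_pred z0)) z.
have ep z : (@rot_label n.+1 @^-1: B == cls f z) = p (ordS z).
  apply/eqP/eqP => [e|e]; apply/setP => y.
    by rewrite mem_cls ordSK -mem_cls -e inE /rot_label /= ord_predK.
  by rewrite inE e mem_cls /rot_label !ordSK mem_cls.
case: pickP => [z|nz]; case: pickP => [y|ny] //.
- by rewrite ep /p => /eqP -> /eqP/eqP; rewrite eq_cls ordSK => /eqP ->.
- by rewrite ep ny.
- move=> py; have := nz (ord_pred y); rewrite ep ord_predK => np.
  by have : p y := py; rewrite np.
Qed.

Lemma iter_rot_fib f g f' g' t :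
  rotates f g f' g' t <-> iter t (@rot_ranked n.+1) (fib f g) = fib f' g'.
Proof.
elim: t f g => [|t IH] f g.
  split=> [[h1 h2]|/fib_inj [h1 h2]].
    by apply: eq_fib => [z z'|z]; rewrite -?h1 -?h2.
  by split=> [z z'|z] /=; rewrite ?h1 ?h2.
rewrite iterSr rot_fibE -IH; split=> -[h1 h2]; split=> [z z'|z].
- by rewrite -h1 /rd !iterSr !ord_predK.
- by rewrite -h2 /rd !iterSr !ord_predK.
- by rewrite /rd !iterSr h1 !ordSK.
- by rewrite /rd !iterSr h2 !ordSK.
Qed.

End RankedFibres.

(** * Lattice paths *)

Section Paths.
Variables (a n : nat).
Implicit Types (v : nat -> nat).

(* n.+1 times the height of the path above the line of slope a / n.+1. *)
Definition level v (i : nat) : int :=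
  (n.+1%:Z * (\sum_(j < i) v j)%:Z - a%:Z * i%:Z)%R.

Lemma level0 v : level v 0 = 0%R.
Proof. by rewrite /level big_ord0; lia. Qed.

Lemma levelS v i : level v i.+1 = (level v i + n.+1%:Z * (v i)%:Z - a%:Z)%R.
Proof. by rewrite /level big_ord_recr /=; lia. Qed.

Lemma eq_level v v' i : (forall j, j < i -> v j = v' j) -> level v i = level v' i.
Proof. by move=> e; rewrite /level (eq_bigr (v' \o val)) // => j _; apply: e. Qed.

Lemma height_sum (s : seq nat) i : height s i = \sum_(j < i) run s j.
Proof.
elim: i => [|i IH]; first by rewrite big_ord0 /height take0.
rewrite big_ord_recr -IH /height /run /=.
have [si|si] := ltnP i (size s); first by rewrite (take_nth 0) // sumn_rcons.
by rewrite nth_default // !take_oversize ?addn0 // ltnW.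
Qed.

Lemma slope_le (p i : nat) :
  (slope a n.+1 * i%:R <= p%:R)%R = (0 <= n.+1%:Z * p%:Z - a%:Z * i%:Z)%R.
Proof.
rewrite /slope -(@ler_pM2l rat n.+1%:R) ?ltr0n //.
have -> : (n.+1%:R * (a%:R / n.+1%:R * i%:R) = (a * i)%:R :> rat)%R.
  by rewrite mulrA [(n.+1%:R * _)%R]mulrC divfK ?pnatr_eq0 // natrM.
by rewrite -natrM ler_nat; lia.
Qed.

Lemma slope_lt (p : nat) :
  (slope a n.+1 < p%:R)%R = (0 < n.+1%:Z * p%:Z - a%:Z)%R.
Proof.
rewrite /slope ltr_pdivrMr ?ltr0n // -natrM ltr_nat; lia.
Qed.

Lemma slope_gt (p : nat) :
  (p%:R < slope a n.+1)%R = (n.+1%:Z * p%:Z - a%:Z < 0)%R.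
Proof.
rewrite /slope ltr_pdivlMr ?ltr0n // -natrM ltr_nat; lia.
Qed.

Lemma dyckP (v : n.+1.-tuple nat) :
  reflect (level (run v) n.+1 = 0%R /\ forall i, i <= n.+1 -> (0 <= level (run v) i)%R)
          (dyck a v).
Proof.
apply: (iffP andP) => -[h1 h2].
  have e : \sum_(j < n.+1) run v j = a.
    by rewrite -height_sum /height take_oversize ?size_tuple //; apply/eqP.
  split=> [|i ii]; first by rewrite /level e; lia.
  have /forallP/(_ (Ordinal (ii : i < n.+2))) := h2.
  by rewrite slope_le height_sum.
split.
  have : sumn v = height v n.+1 by rewrite /height take_oversize // size_tuple.
  by rewrite height_sum; move: h1; rewrite /level; nia.
by apply/forallP => i; rewrite slope_le height_sum; apply: h2; rewrite -ltnS.
Qed.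

(** Equal levels at i < j would give n + 1 | a (j - i), hence n + 1 | j - i by coprimality, although
    0 < j - i <= n. *)
Lemma level_walk v : coprime a n.+1 -> level v n.+1 = 0%R ->
  (forall i, 0 < i <= n -> (0 <= level v i)%R) -> walk n (level v).
Proof.
move=> co hn hp.
have dist i j : i < j <= n -> level v i <> level v j.
  move=> ij e; have : n.+1 %| a * (j - i).
    have : n.+1 * \sum_(k < j) v k + a * i = n.+1 * \sum_(k < i) v k + a * j.
      by move: e; rewrite /level; lia.
    rewrite mulnBr => e'; apply/dvdnP.
    by exists (\sum_(k < j) v k - \sum_(k < i) v k); rewrite mulnBl; lia.
  by rewrite Gauss_dvdr 1?coprime_sym // => /dvdn_leq; lia.
split=> //; first exact: level0.
by move=> i ii; have := hp i ii; have := dist 0 i; rewrite level0; lia.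
Qed.

Lemma dyck_walk (v : n.+1.-tuple nat) :
  coprime a n.+1 -> dyck a v -> walk n (level (run v)).
Proof. by move=> co /dyckP[h1 h2]; apply: level_walk => // i ii; apply: h2; lia. Qed.

Lemma meets_stepE (v : seq nat) i j : meets_step a n.+1 v i j =
  (level (run v) i < level (run v) j.+1 + a%:Z)%R && (level (run v) j.+1 < level (run
    v) i)%R.
Proof.
rewrite /meets_step /laser_height /slope !height_sum /level.
set p := \sum_(k < i) _; set q := \sum_(k < j.+1) _.
have lin (x y s t u : rat) : (x != 0 ->
  x * (y + s / x * (t - u)) = x * y + s * t - s * u)%R.
  by move=> x0; field.
have e k : (n.+1%:R * (p%:R + a%:R / n.+1%:R * (k%:R - i%:R))
            = (n.+1 * p + a * k)%:R - (a * i)%:R :> rat)%R.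
  by rewrite natrD !natrM lin ?pnatr_eq0.
congr (_ && _).
  rewrite -(@ltr_pM2l rat n.+1%:R) ?ltr0n // e -natrM ltrBlDr -natrD ltr_nat.
  by lia.
rewrite -(@ltr_pM2l rat n.+1%:R) ?ltr0n // e -natrM ltrBrDr -natrD ltr_nat.
by lia.
Qed.

(** * The partitions of a path as fibres of its keys *)

Section Lasers.
Variable v : seq nat.
Let h := level (run v).
Hypothesis hw : walk n h.

Let hS i : h i.+1 = (h i + n.+1%:Z * (run v i)%:Z - a%:Z)%R.
Proof. exact: levelS. Qed.

Let run_ge0 i : (0 <= n.+1%:Z * (run v i)%:Z)%R.
Proof. by []. Qed.

Let run_gt0 i : 0 < run v i -> (0 < n.+1%:Z * (run v i)%:Z)%R.
Proof. by rewrite pmulr_rgt0. Qed.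

Definition Pkey (z : 'I_n) : nat := last_below h z.+1.
Definition Qkey (z : 'I_n) : nat := laser_end n h z.+1.

(** At the first j with h (j + 1) below the laser, the east step starts above it: either j is later
    than the label and h j is already above, or j is the label itself and its positive run lifts the
    path. Before that the path is above the laser. *)
Lemma laserE (x y : 'I_n) : @laser a n.+1 v x y =
  (0 < run v x.+1) && (Qkey x == y.+1).
Proof.
rewrite /laser /lab; case: (posnP (run v x.+1)) => [//|v0]; rewrite !andTb.
have [Lz hL Ly] := @laser_endP n h x.+1 hw (ltn_ord x);
  rewrite -/(Qkey x) in Lz hL Ly *.
have meets : meets_step a n.+1 v x.+1 (Qkey x).
  rewrite meets_stepE -/h hL andbT [h (Qkey x).+1]hS.
  have [e|/eqP e] := eqVneq (Qkey x) x.+1; first by rewrite e; have := run_gt0 v0; lia.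
  by have := run_ge0 (Qkey x); have := Ly (Qkey x); lia.
have nmeets z : x.+1 <= z < Qkey x -> ~~ meets_step a n.+1 v x.+1 z.
  by move=> xz; rewrite meets_stepE -/h; have := Ly z.+1; lia.
apply/and3P/eqP => [[xy mxy /forallP nm]|e].
  case: (ltngtP (Qkey x) y.+1) => // H; last first.
    by have := nmeets y.+1; rewrite mxy xy H => /(_ isT).
  have kn : (Qkey x).-1 < n by lia.
  have kk : (Qkey x).-1.+1 = Qkey x by rewrite prednK //; lia.
  have /implyP := nm (Ordinal kn); rewrite /= kk meets => np.
  by have := np ltac:(lia).
rewrite -e; split=> //; first by case/andP: Lz.
by apply/forallP => z; apply/implyP => zz; apply: nmeets.
Qed.

Lemma Qkey_bound (z : 'I_n) : z.+1 <= Qkey z <= n.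
Proof. by have [] := @laser_endP n h z.+1 hw (ltn_ord z). Qed.

Lemma Pkey_bound (z : 'I_n) : Pkey z <= z.
Proof. by have [] := @last_belowP n h z.+1 hw (ltn_ord z). Qed.

Lemma above_laserE (x y z : 'I_n) : @above_laser n.+1 x y z = (x < z <= y).
Proof. by []. Qed.

Lemma separatedE (z z' : 'I_n) : @separated a n.+1 v z z' = (Pkey z != Pkey z').
Proof.
(* A label above the laser of x has its key at or after x. A label with the same key that is not
   above the laser lies past its end, where the path has dropped below that key. *)
have sep (z1 z2 x y : 'I_n) : @laser a n.+1 v x y ->
    @above_laser n.+1 x y z1 -> ~~ @above_laser n.+1 x y z2 -> Pkey z1 <> Pkey z2.
  rewrite laserE !above_laserE => /andP[_ /eqP xy] z1a z2a e.
  have [Lz hL Ly] := @laser_endP n h x.+1 hw (ltn_ord x);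
    rewrite -/(Qkey x) in Lz hL Ly *.
  have [M1 hM1 My1] := @last_belowP n h z1.+1 hw (ltn_ord z1).
  have [M2 hM2 My2] := @last_belowP n h z2.+1 hw (ltn_ord z2).
  rewrite -/(Pkey z1) in M1 hM1 My1; rewrite -/(Pkey z2) in M2 hM2 My2.
  have l1 := Ly z1.+1; have xz : x.+1 <= Pkey z1 by have := My1 x.+1; lia.
  have hx : (h x.+1 <= h (Pkey z1))%R.
    by have [->|/eqP e'] := eqVneq x.+1 (Pkey z1); [lia|have := Ly (Pkey z1); lia].
  rewrite e in xz hx M1; have := My2 (Qkey x).+1.
  have [e'|/eqP e'] := eqVneq (Qkey x).+1 z2.+1; last by lia.
  by rewrite -e' in hM2; lia.
(* The separating laser starts at the label [Pkey z2], which is positive since it exceeds [Pkey z1].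
   It passes below z2; if it passed below z1, the key of z1 would be at least [Pkey z2]. *)
have sepC (z1 z2 : 'I_n) : Pkey z1 < Pkey z2 ->
  exists x y : 'I_n, @laser a n.+1 v x y /\
    (@above_laser n.+1 x y z1 != @above_laser n.+1 x y z2).
  move=> l12.
  have [M1 hM1 My1] := @last_belowP n h z1.+1 hw (ltn_ord z1).
  have [M2 hM2 My2] := @last_belowP n h z2.+1 hw (ltn_ord z2).
  rewrite -/(Pkey z1) in M1 hM1 My1; rewrite -/(Pkey z2) in M2 hM2 My2.
  have z2n := ltn_ord z2.
  have xn : (Pkey z2).-1 < n by lia.
  pose x := Ordinal xn; have ex : x.+1 = Pkey z2 by rewrite /= prednK //; lia.
  have yn : (Qkey x).-1 < n by have := Qkey_bound x; lia.
  pose y := Ordinal yn; have ey : y.+1 = Qkey x.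
    by rewrite /= prednK //; have := Qkey_bound x; lia.
  have [Lz hL Ly] := @laser_endP n h x.+1 hw (ltn_ord x).
  rewrite -/(Qkey x) ex in Lz hL Ly.
  exists x, y; rewrite laserE -ey eqxx andbT !above_laserE ex; split.
    have : (h (Pkey z2) < h (Pkey z2).+1)%R.
      by have [->|/eqP e'] := eqVneq (Pkey z2).+1 z2.+1;
        [lia|have := My2 (Pkey z2).+1; lia].
    by rewrite hS; case: posnP => // ->; lia.
  have z2L : z2.+1 <= Qkey x.
    case: (leqP z2.+1 (Qkey x)) => // H; have := My2 (Qkey x).+1.
    have [e'|/eqP e'] := eqVneq (Qkey x).+1 z2.+1; last by lia.
    by rewrite -e' in hM2; lia.
  have : ~~ (Pkey z2 < z1.+1 <= Qkey x).
    by apply/negP => zz; have := My1 (Pkey z2); have := Ly z1.+1; lia.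
  by lia.
rewrite /separated; apply/existsP/idP => [[x /existsP[y /andP[l]]]|].
  have := sep z z' x y l; have := sep z' z x y l.
  by do 2!case: above_laser => //=; move=> A B _; apply/eqP; auto using nesym.
rewrite neq_ltn => /orP[] /sepC[x [y [l ab]]]; exists x; apply/existsP; exists y.
  by rewrite l.
by rewrite l eq_sym.
Qed.

(** Links preserve the key, as the end of a laser is its own key. Conversely each label is joined to
    its key by its laser; a label that fires none is its own key, because the path drops right after
    it. *)
Lemma connect_QlinkE (z z' : 'I_n) :
  connect (@Qlink a n.+1 v) z z' = (Qkey z == Qkey z').
Proof.
have idem (x y : 'I_n) : Qkey x = y.+1 -> Qkey y = y.+1.
  by rewrite /Qkey => e; rewrite -e laser_end_idem //; apply: ltn_ord.
apply/idP/eqP => [/connectP[p]|e].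
  elim: p z => [|y p IH] z /=; first by move=> _ e; rewrite e.
  case/andP => l /IH{IH}IH /IH <-; move: l; rewrite /Qlink !laserE.
  case/or3P => [/existsP[x]|/andP[_ /eqP e]|/andP[_ /eqP e]].
  - by rewrite !laserE => /and3P[/andP[_ /eqP ->] /andP[_ /eqP ->]].
  - by rewrite (idem _ _ e).
  - by rewrite e (idem _ _ e).
have link (x : 'I_n) : exists2 y : 'I_n, Qkey x = y.+1 &
    connect (@Qlink a n.+1 v) x y && connect (@Qlink a n.+1 v) y x.
  have yn : (Qkey x).-1 < n by have := Qkey_bound x; lia.
  pose y := Ordinal yn; have ey : Qkey x = y.+1.
    by rewrite /= prednK //; have := Qkey_bound x; lia.
  exists y => //; case: (posnP (run v x.+1)) => v0; last first.
    have l : @laser a n.+1 v x y by rewrite laserE v0 ey eqxx.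
    by rewrite !connect1 // /Qlink l ?orbT.
  suff e2 : Qkey x = x.+1.
    by have -> : y = x by [apply: ord_inj; lia]; rewrite !connect0.
  have xn := ltn_ord x.
  apply: (laser_end_eq hw); [lia|lia| |by move=> t; lia].
  have [_ hn hp _] := hw.
  have : (0 < a%:Z)%R by have := hp n; have := hS n; have := run_ge0 n; lia.
  by rewrite hS v0; lia.
have [y ey /andP[zy _]] := link z; have [y' ey' /andP[_ zy']] := link z'.
by apply: (connect_trans zy); rewrite (_ : y = y') //; apply: ord_inj; lia.
Qed.

Lemma bmin_eq (B : {set 'I_n}) z : z \in B -> (forall y, y \in B -> z <= y) ->
  @bmin n.+1 B = z.+1.
Proof.
move=> zB zm; apply/eqP; rewrite eqn_leq /bmin; apply/andP; split.
  elim: (index_enum _) (mem_index_enum z) => // y s IH.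
  rewrite inE big_cons => /predU1P[<-|/IH{}IH]; first by rewrite zB geq_minl.
  by case: ifP => // _; rewrite geq_min IH orbT.
apply: (big_ind (fun m => z < m)) => [|m m' zm1 zm2|y /zm //].
  by apply: leq_trans (ltn_ord z) _.
by rewrite leq_min zm1.
Qed.

Lemma bmax_eq (B : {set 'I_n}) z : z \in B -> (forall y, y \in B -> y <= z) ->
  @bmax n.+1 B = z.+1.
Proof.
move=> zB zm; apply/eqP; rewrite eqn_leq; apply/andP; split.
  by apply/bigmax_leqP => y /zm.
exact: (leq_bigmax_cond (F := @lab n.+1)).
Qed.

Lemma bmin_Pkey z : @bmin n.+1 (cls Pkey z) = (Pkey z).+1.
Proof.
have [Mz hM My] := @last_belowP n h z.+1 hw (ltn_ord z); rewrite -/(Pkey z) in Mz hM My.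
have xn : Pkey z < n by have := ltn_ord z; lia.
rewrite (@bmin_eq _ (Ordinal xn)) // => [|y]; rewrite mem_cls.
  by apply/eqP; rewrite /Pkey /= (last_below_succ hw) //; apply: ltn_ord.
by move=> /eqP ey; rewrite /= -ey; exact: Pkey_bound.
Qed.

Lemma bmax_Qkey z : @bmax n.+1 (cls Qkey z) = Qkey z.
Proof.
have := Qkey_bound z => b; have xn : (Qkey z).-1 < n by lia.
have e : (Ordinal xn).+1 = Qkey z by rewrite /= prednK //; lia.
rewrite (@bmax_eq _ (Ordinal xn)) // => [|y]; rewrite mem_cls.
  by apply/eqP; rewrite {1}/Qkey e laser_end_idem //; apply: ltn_ord.
by move=> /eqP ey; have := Qkey_bound y; lia.
Qed.

Lemma Ppart_fib : @mk_ranked n.+1 (Ppart a n.+1 v) (fun B => run v (bmin B).-1)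
  = fib Pkey (run v).
Proof.
rewrite -(@mk_ranked_fib _ Pkey _ (fun B => run v (@bmin n.+1 B).-1)).
  congr mk_ranked; apply: eq_imset => z; apply/setP => y; rewrite mem_cls inE in_setT.
  by rewrite separatedE negbK eq_sym.
by move=> z; rewrite bmin_Pkey.
Qed.

Lemma Qpart_fib : @mk_ranked n.+1 (Qpart a n.+1 v) (fun B => run v (bmax B))
  = fib Qkey (run v).
Proof.
rewrite -(@mk_ranked_fib _ Qkey _ (fun B => run v (@bmax n.+1 B))).
  congr mk_ranked; apply: eq_imset => z; apply/setP => y; rewrite mem_cls inE in_setT.
  by rewrite connect_QlinkE eq_sym.
by move=> z; rewrite bmax_Qkey.
Qed.
End Lasers.
End Paths.

Arguments Pkey : clear implicits.
Arguments Qkey : clear implicits.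

(** * Rotation of a path *)

Section Rotation.
Variables (a n : nat).
Hypotheses (co : coprime a n.+1) (n0 : 0 < n).
Implicit Types (v : n.+1.-tuple nat).

Lemma pi_path_fib v : dyck a v ->
  pi_path a v = (fib (Pkey a n v) (run v), fib (Qkey a n v) (run v)).
Proof.
by move=> /(dyck_walk co) hw; rewrite /pi_path Ppart_fib // Qpart_fib.
Qed.

Lemma run_mktuple (f : nat -> nat) i : i <= n ->
  run [tuple f j | j < n.+1] i = f i.
Proof. by move=> ii; rewrite /run -[i]/(val (Ordinal (ii : i < n.+1))) nth_mktuple. Qed.

Lemma level_mktuple (f : nat -> nat) i : i <= n.+1 ->
  level a n (run [tuple f j | j < n.+1]) i = level a n f i.
Proof. by move=> ii; apply: eq_level => j ji; apply: run_mktuple; lia. Qed.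

Lemma dyck_mktuple (f : nat -> nat) : level a n f n.+1 = 0%R ->
  (forall i, 0 < i <= n -> (0 <= level a n f i)%R) -> dyck a [tuple f j | j < n.+1].
Proof.
move=> hn hp; apply/dyckP; split=> [|i ii]; first by rewrite level_mktuple.
rewrite level_mktuple //; have [->|/eqP e] := eqVneq i n.+1; first by rewrite hn.
by case: (posnP i) => [->|i0]; [rewrite level0|apply: hp; lia].
Qed.

(* x + 1 is the least label of the P-block of the label n.  Its entry v_x moves
   to the front, and its place is taken by the entry v_n of the Q-block of n. *)
Definition rotrun (v : nat -> nat) (x i : nat) : nat :=
  if i == 0 then v x else if i == x.+1 then v n else v i.-1.

Lemma dyck_rot v : dyck a v -> exists2 v' : n.+1.-tuple nat, dyck a v' &
  rotates (Pkey a n v) (run v) (Pkey a n v') (run v') 1 /\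
  rotates (Qkey a n v) (run v) (Qkey a n v') (run v') 1.
Proof.
move=> dv; have hw := dyck_walk co dv; set h := level _ _ _ in hw.
pose x := last_below h n; pose f := rotrun (run v) x.
have [xn hx Mxy] := @last_belowP n h n hw ltac:(lia); rewrite -/x in xn hx Mxy.
have hS i : h i.+1 = (h i + n.+1%:Z * (run v i)%:Z - a%:Z)%R by apply: levelS.
have [h0 hn hp _] := hw.
have fl i : i <= x -> level a n f i.+1 = (h i + h x.+1 - h x)%R.
  elim: i => [|i IH] ix; rewrite levelS.
    by rewrite level0 hS h0 /f /rotrun /=; lia.
  rewrite IH ?(ltnW ix) // [h i.+1]hS /f /rotrun /= ifF; first by lia.
  by lia.
have fr i : x < i <= n -> level a n f i.+1 = (h i - h n)%R.
  elim: i => [|i IH] ix //; rewrite levelS.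
  (* The entry v_n in the place of v_x contributes (n + 1) v_n - a = - h n, because h (n + 1) =
     0. *)
  have [e|/eqP e] := eqVneq i x.
    have := hS n; rewrite e fl // hn /f /rotrun /= eqxx; lia.
  rewrite IH ?hS /f /rotrun /= ?ifF; lia.
have fn : level a n f n.+1 = 0%R by rewrite fr; lia.
have f0 i : 0 < i <= n -> (0 < level a n f i)%R.
  by apply: (@rot_walk_gt0 n h (level a n f)) => //; rewrite level0.
pose v' := [tuple f j | j < n.+1].
have hw'f : walk n (level a n f) by apply: level_walk => // i /f0; lia.
have dv' : dyck a v' by apply: dyck_mktuple => // i /f0; lia.
have hw' := dyck_walk co dv'; set h' := level _ _ _ in hw'.
have h'0 : h' 0 = 0%R by apply: level0.
have h'l i : i <= x -> h' i.+1 = (h i + h x.+1 - h x)%R.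
  by move=> ix; rewrite /h' level_mktuple; [apply: fl|lia].
have h'r i : x < i <= n -> h' i.+1 = (h i - h n)%R.
  by move=> ix; rewrite /h' level_mktuple; [apply: fr|lia].
have vr (z : 'I_n) : rd 1 z = (if z.+1 < n then z.+1 else 0) :> nat.
  by rewrite val_rd_small // addn1; have := ltn_ord z; case: ifP; lia.
have eP (z : 'I_n) : Pkey a n v' (rd 1 z) = if Pkey a n v z == x then
  0 else (Pkey a n v z).+1.
  rewrite /Pkey -/h -/h' vr; case: ifP => [zn|zn].
    by apply: (rot_last_below n0 hw h'0 h'l h'r hw'); lia.
  have -> : z.+1 = n by have := ltn_ord z; lia.
  rewrite eqxx; have [] := @last_belowP n h' 1 hw' ltac:(lia); lia.
have eQ (z : 'I_n) : Qkey a n v' (rd 1 z) = if Qkey a n v z == n then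
  x.+1 else (Qkey a n v z).+1.
  rewrite /Qkey -/h -/h' vr; case: ifP => [zn|zn].
    by apply: (rot_laser_end n0 hw h'0 h'l h'r hw'); lia.
  have -> : z.+1 = n by have := ltn_ord z; lia.
  by rewrite laser_end_last // eqxx (rot_laser_end1 n0 hw h'0 h'l h'r hw').
have kQx z : Qkey a n v z <> x.
  by apply: (@rot_key_neq n h) => //; apply: ltn_ord.
exists v' => //; split; split=> [z z'|z].
- by rewrite !eP; do 2!case: ifP; lia.
- have zn := ltn_ord z; have zb := Pkey_bound hw z; rewrite eP.
  case: ifP => [/eqP ->|e]; first by rewrite run_mktuple.
  by rewrite run_mktuple; [rewrite /f /rotrun /= eqSS e|lia].
- by rewrite !eQ; have := kQx z; have := kQx z'; do 2!case: ifP; lia.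
- have zb := Qkey_bound hw z; rewrite eQ.
  case: ifP => [/eqP ->|e].
    by rewrite run_mktuple; [rewrite /f /rotrun /= eqxx|lia].
  rewrite run_mktuple; last by lia.
  by rewrite /f /rotrun /= ifF //; have := kQx z; lia.
Qed.

Lemma dyck_rots v t : dyck a v -> exists2 v' : n.+1.-tuple nat, dyck a v' &
  rotates (Pkey a n v) (run v) (Pkey a n v') (run v') t /\
  rotates (Qkey a n v) (run v) (Qkey a n v') (run v') t.
Proof.
move=> dv; elim: t => [|t [v1 dv1 [r1 r2]]]; first by exists v.
have [v' dv' [s1 s2]] := dyck_rot dv1; exists v' => //.
have comp (k k1 k' : 'I_n -> nat) g g1 g' : rotates k g k1 g1 t ->
    rotates k1 g1 k' g' 1 -> rotates k g k' g' t.+1.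
  move=> [ra rb] [sa sb]; split=> [z z'|z]; rewrite rdS; first by rewrite -ra -sa.
  by rewrite -rb -sb.
by split; [apply: comp r1 s1|apply: comp r2 s2].
Qed.
End Rotation.

(** * Noncentral, nonwrapping blocks *)

Section Short.
Variables (n d : nat) (f : 'I_n -> nat) (g : nat -> nat).
Hypotheses (d0 : 0 < d) (dn : 2 * d <= n) (ddn : d %| n).
Hypothesis inv : forall z z', (f (rd d z) == f (rd d z')) = (f z == f z').
Hypothesis nc : forall i j k l : 'I_n, i < j -> j < k -> k < l ->
  f i = f k -> f j = f l -> f i = f j.

Let dn' : d <= n. Proof. by lia. Qed.

Let invE z z' : f z = f z' -> f (rd d z) = f (rd d z').
Proof. by move=> e; apply/eqP; rewrite inv e. Qed.

Let invI z z' : f (rd d z) = f (rd d z') -> f z = f z'.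
Proof. by move=> e; apply/eqP; rewrite -inv e. Qed.

Lemma rd_modd (z : 'I_n) : rd d z = z %[mod d].
Proof. by rewrite val_rd modn_dvdm // modnDr. Qed.

(* By noncrossing, a noncentral block of span at least d separates each other
   block of its orbit from the outside. *)
Lemma wide_encloses (i m : 'I_n) : f i = f m -> i + d <= m ->
  f (rd d i) <> f i ->
  forall c c' : 'I_n, c = i %[mod d] -> f c = f c' -> f c <> f i -> i < c' < m.
Proof.
move=> im idm ni; have mn := ltn_ord m.
have vi : rd d i = i + d :> nat by rewrite val_rd_small // ifT //; lia.
have idm' : i + d < m.
  rewrite ltn_neqAle idm andbT -vi; apply/eqP => /ord_inj e.
  by apply: ni; rewrite e.
have fim := invE im; have vm := val_rd_small m dn'.
(* The image of m wraps around and lands after i, since otherwise the block of i and its image would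
   cross. So the gap outside [i, m] is shorter than d, and every other label congruent to i modulo d
   is inside. *)
have rm : i + n < m + d.
  case: ltnP vm => [H vm|H vm].
    by case: ni; rewrite (@nc i (rd d i) m (rd d m)) //; lia.
  case: (ltngtP (rd d m) i) => [H'|H'|/ord_inj e]; last 1 first.
  - by case: ni; rewrite fim e.
  - by case: ni; rewrite fim (@nc (rd d m) i (rd d i) m) //; lia.
  - by lia.
move=> c c' cm cc' ci; have cn := ltn_ord c.
have ci' : c <> i :> nat by move=> /ord_inj e; apply: ci; rewrite e.
have cim : i < c < m.
  have ei : i %% d = i by rewrite modn_small //; lia.
  rewrite ei in cm; have := divn_eq c d; rewrite cm.
  have /dvdnP[k ek] := ddn; set q := c %/ d => ec.
  have qk : q < k by rewrite -(ltn_pmul2r d0) -ek; lia.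
  by have := leq_mul qk (leqnn d); rewrite mulSn; lia.
case: (ltngtP c' i) => [H|H|/ord_inj e].
- by case: ci; rewrite cc' (@nc c' i c m) //; lia.
- case: (ltngtP c' m) => [//|H'|/ord_inj e].
    by case: ci; rewrite (@nc i c m c') //; lia.
  by case: ci; rewrite cc' e.
- by case: ci; rewrite cc' e.
Qed.

(** If both blocks had span at least d, each would strictly enclose the other. *)
Lemma wide_rot_short (i m : 'I_n) : f i = f m -> i + d <= m ->
  f (rd d i) <> f i ->
  forall y y', f y = f (rd d i) -> f y' = f (rd d i) -> y < y' + d.
Proof.
move=> im idm ni y y' fy fy'; case: ltnP => // yy'; exfalso.
have ny : f (rd d y') <> f y'.
  by move=> e; apply: ni; apply: invI; rewrite -fy' -(invE fy') e.
have [t et] := rd_surj d y'.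
have ft : f t = f i by apply: invI; rewrite -et.
have /= := @wide_encloses y' y _ yy' ny t i _ ft.
have := wide_encloses im idm ni (@rd_modd i) (esym fy') ni.
rewrite fy' fy et rd_modd ft => h1 h2.
by have := h2 erefl erefl (nesym ni); lia.
Qed.

Definition short (z : 'I_n) : Prop :=
  forall x y, f x = f z -> f y = f z -> x < y + d.

Lemma rotd_cls z : @rotd_block n.+1 d (cls f z) = cls f (rd d z).
Proof.
have -> : forall B : {set 'I_n}, @rotd_block n.+1 d B = [set rd d x | x in B].
  move=> B; rewrite /rotd_block; elim: d => [|t IH]; first by rewrite imset_id.
  by rewrite iterS IH /rot_block -imset_comp; apply: eq_imset.
apply/setP => y; rewrite mem_cls; have [t ->] := rd_surj d y.
by rewrite mem_imset ?mem_cls ?inv //; apply: rd_inj.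
Qed.

Lemma centralE z : @central n.+1 d (cls f z) = (f (rd d z) == f z).
Proof. by rewrite /central rotd_cls eq_cls. Qed.

Lemma cls_min z : exists2 i, f i = f z & forall y, f y = f z -> i <= y.
Proof.
case: (@arg_minnP _ z (fun y => f y == f z) (@nat_of_ord n) (eqxx _)) => i /eqP fi hi.
by exists i => // y /eqP /hi.
Qed.

Lemma cls_max z : exists2 m, f m = f z & forall y, f y = f z -> y <= m.
Proof.
case: (@arg_maxnP _ z (fun y => f y == f z) (@nat_of_ord n) (eqxx _)) => i /eqP fi hi.
by exists i => // y /eqP /hi.
Qed.

(** A noncentral block of span at least d encloses its orbit. In a block of smaller span no label
    occurs with its image, which is d or n - d >= d away, and the image of the minimum falls outside
    the span. *)
Lemma shortP z : reflect (short z)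
  (~~ @central n.+1 d (cls f z) && ~~ @wrapping n.+1 d (cls f z)).
Proof.
suff H : ~~ @central n.+1 d (cls f z) && ~~ @wrapping n.+1 d (cls f z) <-> short z.
  by apply: (iffP idP) => /H.
have [i fi hi] := cls_min z; have [m fm hm] := cls_max z.
have eb : [set x : 'I_n | @bmin n.+1 (cls f z) <= @lab n.+1 x <= @bmax n.+1 (cls f z)]
    = [set x : 'I_n | i <= x <= m].
  rewrite (@bmin_eq n (cls f z) i) ?mem_cls ?fi //; last by move=> y;
    rewrite mem_cls => /eqP /hi.
  rewrite (@bmax_eq n (cls f z) m) ?mem_cls ?fm //; last by move=> y;
    rewrite mem_cls => /eqP /hm.
rewrite /wrapping eb centralE; have vi := val_rd_small i dn'.
have eri : (f (rd d z) == f z) = (f (rd d i) == f i) by rewrite -(invE fi) -fi.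
rewrite eri; split=> [/andP[ni]|sz].
  rewrite ni /=; move/eqP: ni => ni /forallPn[C]; rewrite negb_imply => /andP[oC nC].
  move=> x y fx fy; case: ltnP => // yx; case/negP: nC.
  have idm : i + d <= m by have := hi _ fy; have := hm _ fx; lia.
  have im : f i = f m by rewrite fi fm.
  have [t tm ->] : exists2 t : 'I_n, t = i %[mod d] & C = cls f t.
    move: oC; rewrite -fconnect_orbit => /iter_findex <-.
    elim: findex => [|s [t tm IH]]; first by exists i => //; apply/eqP;
      rewrite eq_cls fi.
    by exists (rd d t); [rewrite rd_modd|rewrite -rotd_cls -IH].
  apply/subsetP => c; rewrite mem_cls inE => /eqP fc.
  have [e|/eqP nt] := eqVneq (f t) (f i).
    by rewrite hi ?hm // fc e fi.
  by have := wide_encloses im idm ni tm (esym fc) nt; lia.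
have ni : f (rd d i) <> f i.
  move=> e; case: ltnP vi => [H vi|H vi].
    by have := sz (rd d i) i; rewrite e fi vi => /(_ erefl erefl); lia.
  have [t et] := rd_surj d i.
  have ft : f t = f z by rewrite -fi; apply: invI; rewrite -et e.
  have := hi _ ft; have := sz t i ft fi; have := val_rd_small t dn'; rewrite -et.
  by have := ltn_ord t; case: ifP; lia.
apply/andP; split; first by apply/eqP.
rewrite negb_and negbK; apply/orP; right; apply/forallPn.
exists (@rotd_block n.+1 d (cls f z)); rewrite negb_imply.
rewrite mem_orbit ?in_orbit // rotd_cls /=.
apply/negP => /subsetP /(_ (rd d i)); rewrite mem_cls inE.
rewrite (invE fi) eqxx => /(_ isT); have := sz m i fm fi.
by move: vi; case: ifP; have := ltn_ord i; lia.
Qed.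

Definition minshort (z : 'I_n) : bool :=
  [forall y, (f y == f z) ==> (z <= y < z + d)].

Definition maxshort (z : 'I_n) : bool :=
  [forall y, (f y == f z) ==> (y <= z < y + d)].

Lemma rank_at_min (z : 'I_n) : rank_at d (fib f g) (fun B => bmin B == z.+1)
  = if minshort z then g (f z) else 0.
Proof.
rewrite /rank_at; case: pickP => [B /and3P[/fib_block[t ->] /eqP bt] /shortP st|nB].
  have [i fi hi] := cls_min t.
  have iz : i = z.
    apply: ord_inj; apply: succn_inj; rewrite -bt.
    by rewrite (@bmin_eq n _ i) ?mem_cls ?fi // => y; rewrite mem_cls => /eqP;
      apply: hi.
  rewrite fib_cls -fi iz ifT //=; apply/forallP => y; apply/implyP => /eqP fy.
  rewrite iz in fi hi; rewrite fi in fy.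
  by rewrite hi //= st.
case: ifP => // /forallP ms; have := nB (cls f z).
have zy y : f y = f z -> z <= y < z + d by move=> fy; apply: (implyP (ms y)); apply/eqP.
rewrite fib_cls (@bmin_eq n _ z) ?cls_self ?eqxx //=; last first.
  by move=> y; rewrite mem_cls => /eqP /zy /andP[].
have /shortP -> // : short z.
by move=> x y /zy ? /zy ?; lia.
Qed.

Lemma rank_at_max (z : 'I_n) : rank_at d (fib f g) (fun B => bmax B == z.+1)
  = if maxshort z then g (f z) else 0.
Proof.
rewrite /rank_at; case: pickP => [B /and3P[/fib_block[t ->] /eqP bt] /shortP st|nB].
  have [i fi hi] := cls_max t.
  have iz : i = z.
    apply: ord_inj; apply: succn_inj; rewrite -bt.
    by rewrite (@bmax_eq n _ i) ?mem_cls ?fi // => y; rewrite mem_cls => /eqP;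
      apply: hi.
  rewrite fib_cls -fi iz ifT //=; apply/forallP => y; apply/implyP => /eqP fy.
  rewrite iz in fi hi; rewrite fi in fy.
  by rewrite hi //= st.
case: ifP => // /forallP ms; have := nB (cls f z).
have zy y : f y = f z -> y <= z < y + d by move=> fy; apply: (implyP (ms y)); apply/eqP.
rewrite fib_cls (@bmax_eq n _ z) ?cls_self ?eqxx //=; last first.
  by move=> y; rewrite mem_cls => /eqP /zy /andP[].
have /shortP -> // : short z.
by move=> x y /zy ? /zy ?; lia.
Qed.
End Short.

(** * Short blocks under rotation by one *)

Section Shift.
Variables (n d : nat).
Hypotheses (d0 : 0 < d) (dn : 2 * d <= n).

Lemma lo_subproof (i : 'I_d) : i < n.
Proof. by have := ltn_ord i; lia. Qed.
Definition lo (i : 'I_d) : 'I_n := Ordinal (lo_subproof i).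

Lemma hi_subproof (i : 'I_d) : n - d + i < n.
Proof. by have := ltn_ord i; lia. Qed.
Definition hi (i : 'I_d) : 'I_n := Ordinal (hi_subproof i).

Let vlo i : lo i = i :> nat. Proof. by []. Qed.
Let vhi i : hi i = n - d + i :> nat. Proof. by []. Qed.

Section Rotate.
Variables (f f' : 'I_n -> nat) (g g' : nat -> nat).
Hypothesis inv : rotates f g f g d.
Hypothesis rot : rotates f g f' g' 1.

Let v1 (z : 'I_n) : rd 1 z = (if z.+1 < n then z.+1 else 0) :> nat.
Proof. by rewrite val_rd_small ?addn1; [case: ifP; have := ltn_ord z; lia|lia]. Qed.

Let vd (z : 'I_n) : rd d z = (if z + d < n then z + d else z + d - n) :> nat.
Proof. by rewrite val_rd_small //; lia. Qed.

Let forallb_eq (p q : pred 'I_n) (s : 'I_n -> 'I_n) : (forall z, exists y, z = s y) ->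
  (forall y, p (s y) = q y) -> [forall z, p z] = [forall z, q z].
Proof.
move=> ss pq; apply/forallP/forallP => H z; first by rewrite -pq.
by have [y ->] := ss z; rewrite pq.
Qed.

Let vpred (i : 'I_d) : ord_pred i = (if i == 0 :> nat then d.-1 else i.-1) :> nat.
Proof.
have id := ltn_ord i; case: (posnP i) => i0 /=.
  by rewrite i0 modn_small //; lia.
have -> : (i + d).-1 = i.-1 + d by lia.
by rewrite modnDr modn_small ?ifF //; lia.
Qed.

Lemma minshort_rot (i : 'I_d) :
  (minshort d f' (lo i) = minshort d f (lo (ord_pred i))) *
  (g' (f' (lo i)) = g (f (lo (ord_pred i)))).
Proof.
have [r1 r2] := rot; have [e1 e2] := inv; have id := ltn_ord i.
case: (posnP i) => i0.
  (* The label 1 comes from n, whose block before rotation may straddle the end of the label range.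
     By invariance n is replaced by its image d, where a short block with this minimum fits into d,
     ..., 2d - 1. *)
  have n1 : n.-1 < n by lia.
  pose t : 'I_n := Ordinal n1.
  have et : lo i = rd 1 t by apply: ord_inj; rewrite v1 /= i0; case: ifP; lia.
  have es : lo (ord_pred i) = rd d t.
    by apply: ord_inj; rewrite vd [LHS]vpred i0 /=; case: ifP; lia.
  split; last by rewrite et es r2 e2.
  transitivity [forall y, (f y == f t) ==> (0 <= rd 1 y < d)].
    apply: (forallb_eq (rd_surj 1)) => y; rewrite {1}et r1; congr (_ ==> _).
    by rewrite /= i0.
  rewrite /minshort; apply/esym; apply: (forallb_eq (rd_surj d)) => y.
  rewrite {1}es e1; congr (_ ==> _); rewrite v1 vd es vd /=.
  by have := ltn_ord y; do 3!case: ifP; lia.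
have et : lo i = rd 1 (lo (ord_pred i)).
  by apply: ord_inj; rewrite v1 !vlo vpred; do 2!case: ifP; lia.
split; last by rewrite et r2.
rewrite /minshort; apply: (forallb_eq (rd_surj 1)) => y.
rewrite {1}et r1; case: eqP => // _; rewrite !implyTb v1 !vlo vpred.
by have := ltn_ord y; do 2!case: ifP; lia.
Qed.

Lemma maxshort_rot (i : 'I_d) :
  (maxshort d f' (hi i) = maxshort d f (hi (ord_pred i))) *
  (g' (f' (hi i)) = g (f (hi (ord_pred i)))).
Proof.
have [r1 r2] := rot; have [e1 e2] := inv; have id := ltn_ord i.
case: (posnP i) => i0.
  (* The first label of the window for maxima comes from n - d, just outside the window; it is
     replaced by its image n. *)
  have n1 : n - d - 1 < n by lia.
  pose t : 'I_n := Ordinal n1.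
  have et : hi i = rd 1 t by apply: ord_inj; rewrite v1 /= i0; case: ifP; lia.
  have es : hi (ord_pred i) = rd d t.
    apply: ord_inj; rewrite vd vhi vpred i0 /=.
    by case: ifP; lia.
  split; last by rewrite et es r2 e2.
  transitivity [forall y, (f y == f t) ==> (rd 1 y <= n - d < rd 1 y + d)].
    apply: (forallb_eq (rd_surj 1)) => y; rewrite {1}et r1; congr (_ ==> _).
    by rewrite /= i0 addn0.
  rewrite /maxshort; apply/esym; apply: (forallb_eq (rd_surj d)) => y.
  rewrite {1}es e1; congr (_ ==> _); rewrite v1 vd es vd /=.
  by have := ltn_ord y; do 3!case: ifP; lia.
have et : hi i = rd 1 (hi (ord_pred i)).
  by apply: ord_inj; rewrite v1 !vhi vpred; do 2!case: ifP; lia.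
split; last by rewrite et r2.
rewrite /maxshort; apply: (forallb_eq (rd_surj 1)) => y.
rewrite {1}et r1; case: eqP => // _; rewrite !implyTb v1 !vhi vpred.
by have := ltn_ord y; do 2!case: ifP; lia.
Qed.
End Rotate.
End Shift.

(** * Invariant paths and their sequence pairs *)

Section Invariant.
Variables (a n d : nat).
Hypotheses (co : coprime a n.+1) (d0 : 0 < d) (dn : 2 * d <= n) (ddn : d %| n).
Implicit Types (v : n.+1.-tuple nat).

Let n0 : 0 < n. Proof. by clear ddn; lia. Qed.

Lemma iter_rot_pair t (PQ : ranked n.+1 * ranked n.+1) :
  iter t (@rot_pair n.+1) PQ =
  (iter t (@rot_ranked n.+1) PQ.1, iter t (@rot_ranked n.+1) PQ.2).
Proof. by elim: t => [|t IH]; [case: PQ|rewrite iterS IH]. Qed.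

Lemma pi_rotates v v' t : dyck a v -> dyck a v' ->
  iter t (@rot_pair n.+1) (pi_path a v) = pi_path a v' <->
  rotates (Pkey a n v) (run v) (Pkey a n v') (run v') t /\
  rotates (Qkey a n v) (run v) (Qkey a n v') (run v') t.
Proof.
move=> dv dv'; rewrite iter_rot_pair !(pi_path_fib co) //= !iter_rot_fib.
by split=> [[-> ->]|[-> ->]].
Qed.

Lemma pi_rot v t : dyck a v ->
  exists2 v' : n.+1.-tuple nat, dyck a v'
    & pi_path a v' = iter t (@rot_pair n.+1) (pi_path a v).
Proof.
move=> dv; have [v' dv' r] := dyck_rots co n0 t dv.
by exists v' => //; apply/esym/pi_rotates.
Qed.

Lemma NC_rot (PQ : ranked n.+1 * ranked n.+1) t :
  NCd a d PQ -> NCd a d (iter t (@rot_pair n.+1) PQ).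
Proof.
move=> [[v dv ->] e]; have [v' dv' e'] := pi_rot t dv.
by split; [exists v'|rewrite -iterD addnC iterD e].
Qed.

Definition invpath v : Prop :=
  dyck a v /\ iter d (@rot_pair n.+1) (pi_path a v) = pi_path a v.

Lemma NCdP (PQ : ranked n.+1 * ranked n.+1) :
  NCd a d PQ -> exists2 v : n.+1.-tuple nat, invpath v & PQ = pi_path a v.
Proof. by move=> [[v dv ->] e]; exists v. Qed.

Lemma invpath_rot v t : invpath v -> exists2 v' : n.+1.-tuple nat, invpath v'
  & pi_path a v' = iter t (@rot_pair n.+1) (pi_path a v).
Proof.
move=> [dv ev]; have H : NCd a d (pi_path a v) by split; first by exists v.
by have [v' iv' e] := NCdP (NC_rot t H); exists v'.
Qed.

Lemma Pkey_noncross v : dyck a v -> forall i j k l : 'I_n, i < j -> j < k -> k < l ->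
  Pkey a n v i = Pkey a n v k -> Pkey a n v j = Pkey a n v l ->
    Pkey a n v i = Pkey a n v j.
Proof.
move=> /(dyck_walk co) hw i j k l ij jk kl.
by apply: (last_below_noncross hw) => //; apply: ltn_ord.
Qed.

Lemma Qkey_noncross v : dyck a v -> forall i j k l : 'I_n, i < j -> j < k -> k < l ->
  Qkey a n v i = Qkey a n v k -> Qkey a n v j = Qkey a n v l ->
    Qkey a n v i = Qkey a n v j.
Proof.
move=> /(dyck_walk co) hw i j k l ij jk kl.
by apply: (laser_end_noncross hw) => //; apply: ltn_ord.
Qed.

Lemma S_pi v : invpath v -> S_pair d (pi_path a v) =
  ([ffun i => if minshort d (Pkey a n v) (lo d0 dn i) then
    run v (Pkey a n v (lo d0 dn i)) else 0],
   [ffun i => if maxshort d (Qkey a n v) (hi d0 dn i) then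
     run v (Qkey a n v (hi d0 dn i)) else 0]).
Proof.
move=> [dv /(pi_rotates d dv dv)[[r1 _] [s1 _]]].
rewrite (pi_path_fib co) // /S_pair; congr pair; apply/ffunP => i; rewrite !ffunE.
  by rewrite -(rank_at_min _ d0 dn ddn r1 (Pkey_noncross dv)).
rewrite -(rank_at_max _ d0 dn ddn s1 (Qkey_noncross dv)).
by rewrite subn1 addnS.
Qed.

Lemma S_rot PQ : NCd a d PQ ->
  S_pair d (@rot_pair n.+1 PQ) = shift_pair (S_pair d PQ).
Proof.
move=> H; have [v iv e] := NCdP H; have [v' iv' e'] := NCdP (NC_rot 1 H).
rewrite /= in e'; rewrite e' e !S_pi //; rewrite e in e'.
have [dv /(pi_rotates d dv dv) [r s]] := iv; have [dv' _] := iv'.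
have [r1 s1] := (pi_rotates 1 dv dv').1 e'.
rewrite /shift_pair /=; congr pair; apply/ffunP => i; rewrite !ffunE.
  by rewrite !(minshort_rot d0 dn r r1).
by rewrite !(maxshort_rot d0 dn s s1).
Qed.

Lemma S_rots PQ t : NCd a d PQ ->
  S_pair d (iter t (@rot_pair n.+1) PQ) = iter t (@shift_pair d) (S_pair d PQ).
Proof. by move=> H; elim: t => //= t <-; rewrite S_rot //; apply: NC_rot. Qed.
End Invariant.

(** * The central block *)

Section Central.
Variables (a n d : nat).
Hypotheses (co : coprime a n.+1) (d0 : 0 < d) (dn : 2 * d <= n) (ddn : d %| n).
Implicit Types (v : n.+1.-tuple nat).

(* Given rot^d-invariance: the Q-block of the label n, resp. the P-block of the
   label 1, is central. *)
Definition Qcentral v : Prop := laser_end n (level a n (run v)) d = n.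
Definition Pcentral v : Prop := last_below (level a n (run v)) d.+1 = 0.

(* If a P-block is short, rotate it so as to contain 1.  Its maximum m and n then
   lie in the same Q-block: either that block is central, or its image under
   rot^d is short and has larger span.  The case of a Q-block is dual, and the
   spans are less than d. *)
Lemma exists_rot_central v : invpath a d v ->
  exists t (v' : n.+1.-tuple nat),
    [/\ invpath a d v', pi_path a v' = iter t (@rot_pair n.+1) (pi_path a v)
      & Qcentral v' \/ Pcentral v'].
Proof.
have vd (z : 'I_n) : rd d z = (if z + d < n then z + d else z + d - n) :> nat.
  by rewrite val_rd_small //; lia.
have n0 : 0 < n by lia.
have nl : n.-1 < n by lia.
have d1n : d.-1 < n by lia.
have dln : d < n by lia.
pose o0 : 'I_n := Ordinal n0; pose om : 'I_n := Ordinal nl.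
pose od1 : 'I_n := Ordinal d1n; pose od : 'I_n := Ordinal dln.
have rdm : rd d om = od1 by apply: ord_inj; rewrite vd /=; case: ifP; lia.
have rd0 : rd d o0 = od by apply: ord_inj; rewrite vd /=; case: ifP; lia.
have Qod (u : n.+1.-tuple nat) : Qkey a n u od1 = n ->
  laser_end n (level a n (run u)) d = n.
  by rewrite /Qkey /= prednK.
have dy (u : n.+1.-tuple nat) : dyck a u -> Pkey a n u o0 = 0 /\ Qkey a n u om = n.
  move=> /(dyck_walk co) hw; split; first by have := Pkey_bound hw o0; rewrite /=; lia.
  by have := Qkey_bound hw om; rewrite /=; lia.
(* k bounds what the span y - x of the short block lacks to d. Each round enlarges the span by at
   least 1, and k = 0 contradicts shortness. *)
have step k : forall v : n.+1.-tuple nat, invpath a d v ->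
  (exists x y : 'I_n, d <= (y - x) + k /\
      ((Pkey a n v x = Pkey a n v y /\ short d (Pkey a n v) x) \/
       (Qkey a n v x = Qkey a n v y /\ short d (Qkey a n v) x))) ->
    exists t (v' : n.+1.-tuple nat),
    [/\ invpath a d v', pi_path a v' = iter t (@rot_pair n.+1) (pi_path a v)
      & Qcentral v' \/ Pcentral v'].
  elim: k => [|k IH] u iu [x [y [dxy]]].
    by case=> -[e sh]; have := sh y x (esym e) erefl; lia.
  have [du eu] := iu; have hw := dyck_walk co du.
  case=> -[e sh].
    have [i fi hi] := cls_min (Pkey a n u) x.
    have [u' iu' pu'] := invpath_rot co d0 dn (n - i) iu.
    have [du' eu'] := iu'; have hw' := dyck_walk co du'.
    have [[r1 _] _] := (pi_rotates co _ du du').1 (esym pu').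
    have [[s1 _] [s2 _]] := (pi_rotates co _ du' du').1 eu'.
    have [k0 km] := dy u' du'.
    have vt (z : 'I_n) : Pkey a n u z = Pkey a n u x -> rd (n - i) z = z - i :> nat.
      move=> fz; have := hi _ fz; have := sh z i fz fi; have := ltn_ord z.
      by rewrite val_rd_small; [case: ifP|]; lia.
    have ei : rd (n - i) i = o0 by apply: ord_inj; rewrite vt //=; lia.
    have [m fm hm] := cls_max (Pkey a n u') o0.
    have mlow : y - x <= m.
      have fy : Pkey a n u' (rd (n - i) y) = Pkey a n u' o0.
        by apply/eqP; rewrite -ei r1 -e fi.
      by have := hm _ fy; rewrite vt //; have := hi _ erefl; lia.
    have mup : m < d.
      have [t et] := rd_surj (n - i) m.
      have ft : Pkey a n u t = Pkey a n u x.
        by rewrite -fi; apply/eqP; rewrite -r1 -et ei fm.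
      by rewrite et vt //; have := sh t i ft fi; lia.
    (* Otherwise the point where the path first drops below m would be lower than all labels before
       it, hence in the P-block of 1 beyond its maximum. *)
    have qm : Qkey a n u' m = n.
      have [Lz hL Ly] := @laser_endP n _ m.+1 hw' (ltn_ord m).
      have [_ _ My] := @last_belowP n _ m.+1 hw' (ltn_ord m).
      rewrite -/(Qkey a n u' m) in Lz hL Ly; rewrite -/(Pkey a n u' m) fm k0 in My.
      case: (ltnP (Qkey a n u' m) n) => H; last by lia.
      have e1 : Pkey a n u' (Ordinal H) = 0.
        apply: (last_below_eq hw') => //=.
          by have [w0 _ wp _] := hw'; rewrite w0; apply: wp; lia.
        move=> t tL; case: (ltngtP t m.+1) => [tm|tm|->] //.
          by have := My t; lia.
        by have := Ly t; lia.
      by have := hm (Ordinal H); rewrite e1 k0 /=; lia.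
    case: (eqVneq (Qkey a n u' od1) n) => [e1|/eqP e1].
      by exists (n - i), u'; split=> //; left; apply: Qod.
    have nc := Qkey_noncross co du'.
    have mom : Qkey a n u' m = Qkey a n u' om by rewrite qm km.
    have rdom : Qkey a n u' (rd d m) = Qkey a n u' od1.
      by rewrite -rdm; apply/eqP; rewrite s2 mom.
    have ws : short d (Qkey a n u') (rd d m).
      apply: (wide_rot_short d0 dn ddn s2 nc mom); first by rewrite /=; lia.
      by rewrite rdom qm.
    have [||t [u2 [iu2 pu2 c2]]] := IH u'; first by [].
      (* The ordinals n - 1 and m are sent to d - 1 and m + d, so the new span is at least m + 1 > y
         - x. *)
      exists od1, (rd d m); split; first by rewrite vd /=; case: ifP; lia.
      by right; split=> // ? ?; rewrite -rdom; apply: ws.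
    by exists (t + (n - i)), u2; rewrite iterD -pu'.
  (* Dual case: the Q-block is rotated so that its maximum becomes n, and its minimum m then belongs
     to the P-block of 1. *)
  have [i fi hi] := cls_max (Qkey a n u) x.
  have [u' iu' pu'] := invpath_rot co d0 dn (n - i.+1) iu.
  have [du' eu'] := iu'; have hw' := dyck_walk co du'.
  have [_ [r1 _]] := (pi_rotates co _ du du').1 (esym pu').
  have [[s1 _] [s2 _]] := (pi_rotates co _ du' du').1 eu'.
  have [k0 km] := dy u' du'.
  have vt (z : 'I_n) : Qkey a n u z = Qkey a n u x ->
    rd (n - i.+1) z = z + (n - i.+1) :> nat.
    move=> fz; have := hi _ fz; have := sh i z fi fz; have := ltn_ord i.
    by rewrite val_rd_small; [case: ifP|]; lia.
  have ei : rd (n - i.+1) i = om.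
    by apply: ord_inj; rewrite vt //=; have := ltn_ord i; lia.
  have [m fm hm] := cls_min (Qkey a n u') om.
  have mup : y - x + m < n.
    have fx : Qkey a n u' (rd (n - i.+1) x) = Qkey a n u' om.
      by apply/eqP; rewrite -ei r1 fi.
    have := hm _ fx; rewrite vt //; have := hi _ (esym e).
    by have := ltn_ord i; have := ltn_ord m; have := hi _ erefl; lia.
  have mlow : n <= m + d.
    have [t et] := rd_surj (n - i.+1) m.
    have ft : Qkey a n u t = Qkey a n u x.
      by rewrite -fi; apply/eqP; rewrite -r1 -et ei fm.
    by rewrite et vt //; have := sh i t fi ft; have := ltn_ord i; lia.
  have pm : Pkey a n u' m = 0.
    have [Lz hL Ly] := @laser_endP n _ m.+1 hw' (ltn_ord m).
    have [Mz hM My] := @last_belowP n _ m.+1 hw' (ltn_ord m).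
    rewrite -/(Qkey a n u' m) fm km in Lz hL Ly.
    rewrite -/(Pkey a n u' m) in Mz hM My.
    case: (posnP (Pkey a n u' m)) => // H.
    have pn : (Pkey a n u' m).-1 < n by have := ltn_ord m; lia.
    have e1 : Qkey a n u' (Ordinal pn) = n.
      have mn := ltn_ord m.
      rewrite /Qkey /= prednK //; apply: (laser_end_eq hw'); [lia|lia| |].
        by have [_ wn wp _] := hw'; rewrite wn; apply: wp; lia.
      move=> t tL; case: (ltngtP t m.+1) => [tm|tm|->] //.
        by have := My t; lia.
      by have := Ly t; lia.
    by have := hm (Ordinal pn); rewrite e1 km /=; lia.
  case: (eqVneq (Pkey a n u' od) 0) => [e1|/eqP e1].
    by exists (n - i.+1), u'; split=> //; right.
  have nc := Pkey_noncross co du'.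
  have mom : Pkey a n u' o0 = Pkey a n u' m by rewrite pm k0.
  have ws : short d (Pkey a n u') (rd d o0).
    apply: (wide_rot_short d0 dn ddn s1 nc mom); first by rewrite /=; lia.
    by rewrite rd0 k0.
  have [||t [u2 [iu2 pu2 c2]]] := IH u'; first by [].
    exists (rd d m), (rd d o0); split.
      by rewrite rd0 vd /=; case: ifP; have := ltn_ord m; lia.
    have eo : Pkey a n u' (rd d m) = Pkey a n u' (rd d o0) by apply/eqP; rewrite s1 mom.
    by left; split=> // ? ?; rewrite eo; apply: ws.
  by exists (t + (n - i.+1)), u2; rewrite iterD -pu'.
move=> iv; have [dv ev] := iv; have [k0 km] := dy v dv.
have [[s1 _] _] := (pi_rotates co _ dv dv).1 ev.
case: (eqVneq (Pkey a n v od) 0) => [e1|/eqP e1].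
  by exists 0, v; split=> //; right.
have [m fm hm] := cls_max (Pkey a n v) o0.
(* The induction starts from span 0: the P-block of 1 is short, or it is wide and noncentral and its
   image is short. *)
apply: (step d _ iv); case: (ltnP m d) => md.
  exists o0, o0; split; first by lia.
  by left; split=> // s t /hm ? _; lia.
exists (rd d o0), (rd d o0); split; first by lia.
left; split=> //; apply: (wide_rot_short d0 dn ddn s1 (Pkey_noncross co dv) (esym
  fm)) => //.
by rewrite rd0 k0.
Qed.
End Central.

(** * Paths with an extremal central block *)

Section CentralForm.
Variables (a n d : nat).
Hypotheses (co : coprime a n.+1) (d0 : 0 < d) (dn : 2 * d <= n) (ddn : d %| n).
Implicit Types (v : n.+1.-tuple nat) (w : nat -> nat).

Definition periodic w : Prop := forall i, w (i + d) = w i.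

Let vd (z : 'I_n) : rd d z = (if z + d < n then z + d else z + d - n) :> nat.
Proof. by rewrite val_rd_small //; clear co ddn; lia. Qed.

Let ddnd : exists q, n - d = q * d.
Proof. by have /dvdnP[k ->] := ddn; exists k.-1; case: k => // k;
  rewrite mulSn addKn. Qed.

Let Ldecomp z : 0 < z <= n ->
  exists i s, [/\ z = i + s * d, 0 < i <= d & s * d + d <= n].
Proof.
move=> zn; have e := divn_eq z.-1 d; have r := ltn_pmod z.-1 d0.
have /dvdnP[k ek] := ddn; exists (z.-1 %% d).+1, (z.-1 %/ d); split; try lia.
have : z.-1 %/ d < k by rewrite -(ltn_pmul2r d0) -ek; lia.
by rewrite -(leq_pmul2r d0) mulSn -ek addnC.
Qed.

Lemma periodic_modn w i : periodic w -> w (i %% d) = w i.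
Proof.
move=> pw; rewrite [in RHS](divn_eq i d); elim: (i %/ d) => // q IH.
by rewrite mulSn -addnA addnC pw.
Qed.

Lemma periodic_mul w i q : periodic w -> w (i + q * d) = w i.
Proof. by move=> pw; rewrite -(periodic_modn _ pw) addnC modnMDl periodic_modn. Qed.

(** The free entry v_n does not enter the heights up to n, which therefore grow by h d with each
    period. *)
Lemma Qperiodic_inv v w : dyck a v -> periodic w -> (forall i, i < n ->
  run v i = w i) ->
  invpath a d v /\ Qcentral a d v.
Proof.
move=> dv pw vw; have hw := dyck_walk co dv; set h := level _ _ _ in hw.
have hE i : i <= n -> h i = level a n w i by move=> ii; apply: eq_level => j ji;
  apply: vw; lia.
have hD i : i + d <= n -> h (i + d) = (h i + h d)%R.
  elim: i => [|i IH] ii; first by have [-> _ _ _] := hw; rewrite add0r.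
  by rewrite addSn !hE ?levelS -?hE ?IH ?pw; lia.
have pM := periodic_last_below hw d0 dn ddn hD;
  have pL := periodic_laser_end hw d0 dn ddn hD.
have [q eq] := ddnd.
have rL z := periodic_laser_end_lt hw d0 dn ddn hD (z := z).
split; last exact: periodic_laser_end_d hw d0 dn ddn hD.
split=> //; apply/(pi_rotates co d dv dv).
(* The second conjunct says that the key wraps around whenever its label does, so that the case
   distinction preserves equality of keys. *)
have eP (z : 'I_n) : Pkey a n v (rd d z) =
    (if z + d < n then Pkey a n v z + d else Pkey a n v z + d - n) /\
    (z + d >= n -> n <= Pkey a n v z + d).
  rewrite /Pkey -/h vd; have zn := ltn_ord z.
  have [zd|zd] := ltnP (z + d) n.
    by have := pM z.+1 1; rewrite mul1n addSn => ->; lia.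
  have := pM (z + d - n).+1 q; rewrite -eq (_ : (z + d - n).+1 + (n - d) = z.+1);
    last by lia.
  by move=> e; rewrite e; lia.
have eQ (z : 'I_n) : Qkey a n v (rd d z) =
    (if Qkey a n v z == n then n else if z + d < n then
      Qkey a n v z + d else Qkey a n v z + d - n)
    /\ (Qkey a n v z <> n -> z + d < n -> Qkey a n v z + d < n).
  rewrite /Qkey -/h vd; have zn := ltn_ord z.
  have [zd|zd] := ltnP (z + d) n.
    have [i [[|s] [es i0 sd]]] := @Ldecomp (z + d).+1 ltac:(lia); first by lia.
    have Li := rL i i0; rewrite es pL //; last by lia.
    have -> : z.+1 = i + s * d by lia.
    rewrite pL //; last by lia.
    rewrite mulSn in sd *; case: (laser_end n h i =P n) => Ln; first by rewrite eqxx;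
      split.
    by rewrite ifF; [split=> //; lia|lia].
  have i0 : 0 < (z + d - n).+1 <= d by lia.
  have Li := rL _ i0; have := pL _ q i0; rewrite -eq.
  have -> : (z + d - n).+1 + (n - d) = z.+1 by lia.
  move=> -> //.
  by case: (laser_end n h _ =P n) => Ln; [rewrite eqxx|rewrite ifF; last by lia];
    split=> //; lia.
split; split=> [z z'|z].
- have [-> Hz] := eP z; have [-> Hz'] := eP z'.
  have kz := Pkey_bound hw z; have kz' := Pkey_bound hw z'.
  have zn := ltn_ord z; have zn' := ltn_ord z'.
  by do 2!case: ltnP => ?; lia.
- have [-> Hz] := eP z; have := Pkey_bound hw z; have zn := ltn_ord z => kz.
  case: ltnP => zd; rewrite !vw ?pw //; try lia.
  by rewrite -[in RHS](@subnK (n - d) (Pkey a n v z)) eq ?periodic_mul // -?eq;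
    [congr w|]; lia.
- have [-> Hz] := eQ z; have [-> Hz'] := eQ z'.
  have kz := Qkey_bound hw z; have kz' := Qkey_bound hw z'.
  have zn := ltn_ord z; have zn' := ltn_ord z'.
  by do 2!case: ltnP => ?; do 2!case: (Qkey a n v _ =P n) => ?; lia.
- have [-> Hz] := eQ z; have := Qkey_bound hw z; have zn := ltn_ord z => kz.
  case: eqP => [->//|Ln]; case: ltnP => zd; rewrite !vw ?pw //; try lia.
  by rewrite -[in RHS](@subnK (n - d) (Qkey a n v z)) eq ?periodic_mul // -?eq;
    [congr w|]; lia.
Qed.

(** Here the free entry is v_0, and after it the heights fall with each period. The reversed walk
    rises, so the periodic lemmas apply to it and are carried back by duality. *)
Lemma Pperiodic_inv v w : dyck a v -> periodic w ->
  (forall i, 0 < i <= n -> run v i = w i) -> invpath a d v /\ Pcentral a d v.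
Proof.
move=> dv pw vw; have hw := dyck_walk co dv; set h := level _ _ _ in hw.
have hS i : h i.+1 = (h i + n.+1%:Z * (run v i)%:Z - a%:Z)%R by apply: levelS.
pose D : int := (h d.+1 - h 1)%R.
have hD i : 0 < i -> i + d <= n.+1 -> h (i + d) = (h i + D)%R.
  case: i => // i _; elim: i => [|i IH] ii; first by rewrite add1n /D addrC subrK.
  by rewrite addSn hS IH ?[h i.+2]hS ?(vw i.+1) ?(vw (i.+1 + d)) ?pw; lia.
pose k := fun i => h (n.+1 - i); have kw : walk n k := walk_rev hw.
have kD i : i + d <= n -> k (i + d) = (k i + - D)%R.
  move=> ii; have := hD (n.+1 - (i + d)); rewrite /k.
  by rewrite (_ : n.+1 - (i + d) + d = n.+1 - i); lia.
have pM := periodic_last_below kw d0 dn ddn kD;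
  have pL := periodic_laser_end kw d0 dn ddn kD.
have Lr z : laser_end n h z = n - last_below k (n.+1 - z) by [].
have Mr z (zn : 0 < z <= n) : last_below h z = n - laser_end n k (n.+1 - z) by apply:
  last_below_rev.
have [q eq] := ddnd.
have rL z := periodic_laser_end_lt kw d0 dn ddn kD (z := z).
split; last first.
  rewrite /Pcentral -/h Mr; last by lia.
  have := pL d q.-1 ltac:(lia); rewrite (periodic_laser_end_d kw d0 dn ddn kD) eqxx.
  have q1 : q.-1 * d + d = n - d by rewrite addnC -mulSn prednK //; case: (q) eq; lia.
  by rewrite (_ : n.+1 - d.+1 = d + q.-1 * d) => [->|]; lia.
split=> //; apply/(pi_rotates co d dv dv).
have eQ (z : 'I_n) : Qkey a n v (rd d z) =
    (if z + d < n then Qkey a n v z + d else Qkey a n v z + d - n) /\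
    (z + d < n -> Qkey a n v z + d <= n).
  rewrite /Qkey -/h vd; have zn := ltn_ord z; rewrite !Lr.
  have [zd|zd] := ltnP (z + d) n.
    have [Mb _ _] := @last_belowP n k (n.+1 - z.+1) kw ltac:(lia).
    have := pM (n.+1 - (z + d).+1) 1; rewrite mul1n => e.
    by move: e Mb; rewrite (_ : n.+1 - (z + d).+1 + d = n.+1 - z.+1); lia.
  have [Mb _ _] := @last_belowP n k (n.+1 - z.+1) kw ltac:(lia).
  have := pM (n.+1 - z.+1) q; rewrite -eq => e.
  by move: e Mb; rewrite (_ : n.+1 - z.+1 + (n - d) = n.+1 - (z + d - n).+1); lia.
have eP (z : 'I_n) : Pkey a n v (rd d z) =
    (if Pkey a n v z == 0 then 0 else if z + d < n then
      Pkey a n v z + d else Pkey a n v z + d - n)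
    /\ (Pkey a n v z <> 0 -> n <= z + d -> n < Pkey a n v z + d).
  rewrite /Pkey -/h vd; have zn := ltn_ord z.
  have zn' : 0 < (if z + d < n then z + d else z + d - n).+1 <= n by case: ifP; lia.
  rewrite (Mr z.+1 zn) (Mr _ zn').
  have [zd|zd] := ltnP (z + d) n.
    have [i [[|s] [es i0 sd]]] := @Ldecomp (n.+1 - z.+1) ltac:(lia); first by lia.
    have Li := rL i i0; rewrite es pL //; last by lia.
    have -> : n.+1 - (z + d).+1 = i + s * d by lia.
    have [Lb _ _] := @laser_endP n k i kw ltac:(lia).
    rewrite pL //; last by lia.
    rewrite mulSn in sd *; case: (laser_end n k i =P n) => Ln;
      first by rewrite subnn eqxx.
    by rewrite ifF; [split=> //; lia|lia].
  have i0 : 0 < n.+1 - z.+1 <= d by lia.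
  have := pL (n.+1 - z.+1) q i0; rewrite -eq.
  have -> : n.+1 - z.+1 + (n - d) = n.+1 - (z + d - n).+1 by lia.
  move=> ->; last by lia.
  have [Lb _ _] := @laser_endP n k (n.+1 - z.+1) kw ltac:(lia); have Ll := rL _ i0.
  case: (laser_end n k (n.+1 - z.+1) =P n) => Ln; first by rewrite Ln subnn.
  by rewrite ifF; [split=> //; lia|lia].
split; split=> [z z'|z].
- have [-> Hz] := eP z; have [-> Hz'] := eP z'.
  have kz := Pkey_bound hw z; have kz' := Pkey_bound hw z'.
  have zn := ltn_ord z; have zn' := ltn_ord z'.
  by do 2!case: ltnP => ?; do 2!case: (Pkey a n v _ =P 0) => ?; lia.
- have [-> Hz] := eP z; have := Pkey_bound hw z; have zn := ltn_ord z => kz.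
  case: eqP => [->//|Ln]; case: ltnP => zd; rewrite !vw ?pw //; try lia.
  by rewrite -[in RHS](@subnK (n - d) (Pkey a n v z)) eq ?periodic_mul // -?eq;
    [congr w|]; lia.
- have [-> Hz] := eQ z; have [-> Hz'] := eQ z'.
  have kz := Qkey_bound hw z; have kz' := Qkey_bound hw z'.
  have zn := ltn_ord z; have zn' := ltn_ord z'.
  by do 2!case: ltnP => ?; lia.
- have [-> Hz] := eQ z; have := Qkey_bound hw z; have zn := ltn_ord z => kz.
  case: ltnP => zd; rewrite !vw ?pw //; try lia.
  by rewrite -[in RHS](@subnK (n - d) (Qkey a n v z)) eq ?periodic_mul // -?eq;
    [congr w|]; lia.
Qed.
Definition rise (c : nat) : bool := a < n.+1 * c.

(* w i stands for p_{i+1} or q_i, of which at most one is nonzero. *)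
Definition splitw w : nseqs d * nseqs d :=
  ([ffun i : 'I_d => if rise (w i) then w i else 0],
   [ffun i : 'I_d => if rise (w i.+1) then 0 else w i.+1]).

Lemma rotates_shift (F g : nat -> nat) :
  rotates (fun z : 'I_n => F z.+1) g (fun z : 'I_n => F z.+1) g d ->
  (forall z z', 0 < z -> 0 < z' -> z + d <= n -> z' + d <= n ->
    F (z + d) = F (z' + d) -> F z = F z') /\
  (forall z, 0 < z -> z + d <= n -> g (F (z + d)) = g (F z)).
Proof.
move=> [r1 r2].
have pr z : 0 < z -> z + d <= n ->
    exists y : 'I_n, z = y.+1 /\ z + d = (rd d y).+1.
  move=> z0 zd; have zn : z.-1 < n by lia.
  exists (Ordinal zn); rewrite val_rd_small /=; last by lia.
  by case: ifP; lia.
split=> [z z' z0 z'0 zd z'd|z z0 zd].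
  have [y [-> ->]] := pr z z0 zd; have [y' [-> ->]] := pr z' z'0 z'd.
  by move=> /eqP; rewrite r1 => /eqP.
by have [y [-> ->]] := pr z z0 zd; rewrite r2.
Qed.

(** Rotation by d sends n - d, n to n, d, and n - d + 1, 1 to 1, d + 1. Centrality, expressed near
    the beginning, is thus transported to the other end of the labels. *)
Lemma rotates_wrap (F g : nat -> nat) :
  rotates (fun z : 'I_n => F z.+1) g (fun z : 'I_n => F z.+1) g d ->
  (F n = F d -> F (n - d) = F n) /\ (F d.+1 = F 1 -> F (n - d).+1 = F 1).
Proof.
move=> [r1 _].
have pr z : 0 < z <= n -> exists y : 'I_n,
    z = y.+1 /\ (rd d y).+1 = if z + d <= n then z + d else z + d - n.
  move=> zn; have zn' : z.-1 < n by lia.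
  exists (Ordinal zn'); rewrite val_rd_small /=; last by lia.
  by do 2!case: ifP; lia.
have [y1 [e1 f1]] := pr (n - d) ltac:(lia); have [y2 [e2 f2]] := pr n ltac:(lia).
have [y3 [e3 f3]] := pr (n - d).+1 ltac:(lia); have [y4 [e4 f4]] := pr 1 ltac:(lia).
rewrite subnK ?leqnn in f1; last by lia.
rewrite ifF ?(addnC n) ?addnK in f2; last by lia.
rewrite ifF ?addSn ?subnK ?subSn ?subnn // in f3; try lia.
rewrite ifT ?add1n in f4; last by lia.
split=> e.
  have : F y1.+1 == F y2.+1 by rewrite -r1 f1 f2 e.
  by rewrite -e1 -e2 => /eqP.
have : F y3.+1 == F y4.+1 by rewrite -r1 f3 f4 e.
by rewrite -e3 -e4 => /eqP.
Qed.

Lemma periodic_runs (r : nat -> nat) l u : (forall i, l <= i -> i + d <= u ->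
  r (i + d) = r i) ->
  forall i q, l <= i -> i + q * d <= u -> r (i + q * d) = r i.
Proof.
move=> H i q li; elim: q => [|q IH]; first by rewrite mul0n addn0.
by rewrite mulSn (addnC d) addnA => iu; rewrite H ?IH //; lia.
Qed.

Section Form.
Variable v : n.+1.-tuple nat.
Hypothesis iv : invpath a d v.
Let h := level a n (run v).

Let hw : walk n h. Proof. by apply: dyck_walk; last case: iv. Qed.

Let hS i : h i.+1 = (h i + n.+1%:Z * (run v i)%:Z - a%:Z)%R.
Proof. exact: levelS. Qed.

Let riseE i : rise (run v i) = (h i < h i.+1)%R.
Proof. by rewrite hS /rise; lia. Qed.

Let rise_last_below i : i < n -> rise (run v i) -> last_below h i.+1 = i.
Proof. by rewrite riseE => ii r; apply: (last_below_eq hw) => // y; lia. Qed.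

Let fall i : i <= n -> ~~ rise (run v i) -> (h i.+1 < h i)%R.
Proof.
rewrite riseE => ii nr; have [h0 hn hp hi] := hw.
case: (posnP i) => [i0|i0]; first by move: nr; rewrite i0 h0; have := hp 1; lia.
have [e|/eqP e] := eqVneq i n; first by rewrite e hn; apply: hp; lia.
by have := hi i i.+1; lia.
Qed.

Let fall_gt0 i : i <= n -> ~~ rise (run v i) -> 0 < i.
Proof.
move=> ii r; have := fall ii r; have [h0 hn hp hi] := hw.
by case: (posnP i) => [->|//]; rewrite h0; have := hp 1; lia.
Qed.

Let fall_laser_end i : i <= n -> ~~ rise (run v i) -> laser_end n h i = i.
Proof.
move=> ii r; have := fall ii r; have i0 := fall_gt0 ii r => f.
by apply: (laser_end_eq hw) => //; [lia|lia|move=> y; lia].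
Qed.

Let rise_lt i : i <= n -> rise (run v i) -> i < n.
Proof.
rewrite riseE => ii; have [h0 hn hp _] := hw.
by have [->|] := eqVneq i n; [rewrite hn; have := hp n|]; lia.
Qed.

Let fall_last_below i : i < n -> ~~ rise (run v i) -> last_below h i.+1 < i.
Proof.
move=> ii r; have f := fall (ltnW ii) r.
have [Mz hM My] := @last_belowP n h i.+1 hw ltac:(lia).
by have [e|] := eqVneq (last_below h i.+1) i; [rewrite e in hM|]; lia.
Qed.

Let rise_laser_end i : 0 < i <= n -> rise (run v i) -> i < laser_end n h i.
Proof.
rewrite riseE => ii r; have [Lz hL Ly] := laser_endP hw ii.
by have [e|] := eqVneq i (laser_end n h i); [rewrite -e in hL|]; lia.
Qed.

Let rotM := (rotates_shift ((pi_rotates co d (proj1 iv) (proj1 iv)).1 (proj2 iv)).1).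
Let rotL := (rotates_shift ((pi_rotates co d (proj1 iv) (proj1 iv)).1 (proj2 iv)).2).

(** A fall at i makes i the greatest label of its Q-block. If i + d were not the greatest of its own
    block, that greatest label moved back by d would be a label beyond i in the block of i. *)
Let fall_shift i : 0 < i -> i + d <= n -> ~~ rise (run v i) -> run v (i + d) = run v i.
Proof.
move=> i0 id r; have Li := @fall_laser_end i ltac:(lia) r.
have [inj rk] := rotL; rewrite -/h in inj rk.
have [Lz hL Ly] := @laser_endP n h (i + d) hw ltac:(lia).
have [e|/eqP e] := eqVneq (laser_end n h (i + d)) (i + d).
  by have := rk i i0 id; rewrite e Li.
have idem : laser_end n h (laser_end n h (i + d)) = laser_end n h (i + d) by apply:
  (laser_end_idem hw); lia.
have := inj (laser_end n h (i + d) - d) i; rewrite subnK; last by lia.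
rewrite Li => /(_ ltac:(lia) i0 ltac:(lia) id idem) e'.
by have [Lz' _ _] := @laser_endP n h (laser_end n h (i + d) - d) hw ltac:(lia); lia.
Qed.

(** The dual argument with least labels; the bound on the key ensures that the least label can be
    moved back by d. *)
Let rise_shift i : i + d < n -> rise (run v i) -> d <= last_below h (i.+1 + d) ->
  run v (i + d) = run v i.
Proof.
move=> id r dM; have Mi := @rise_last_below i ltac:(lia) r.
have [inj rk] := rotM; rewrite -/h in inj rk.
have [Mz hM My] := @last_belowP n h (i.+1 + d) hw ltac:(lia).
have [e|/eqP e] := eqVneq (last_below h (i.+1 + d)) (i + d).
  by have := rk i.+1 isT ltac:(lia); rewrite e Mi.
have idem : last_below h (last_below h (i.+1 + d)).+1 = last_below h (i.+1 + d).
  by apply: (last_below_succ hw); lia.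
have := inj (last_below h (i.+1 + d) - d).+1 i.+1.
have -> : (last_below h (i.+1 + d) - d).+1 + d = (last_below h (i.+1 + d)).+1 by lia.
rewrite Mi => /(_ isT isT ltac:(lia) ltac:(lia) idem) e'.
by have [Mz' _ _] := @last_belowP n h (last_below h (i.+1 + d) - d).+1 hw ltac:(lia);
  lia.
Qed.

Let minshortN i : i < d -> ~~ rise (run v i) ->
  forall (z : 'I_n), z = i :> nat -> minshort d (Pkey a n v) z = false.
Proof.
move=> id r z zi; have M := @fall_last_below i ltac:(lia) r.
have xn : last_below h i.+1 < n by lia.
apply/negbTE/forallPn; exists (Ordinal xn); rewrite /Pkey -/h /= zi.
by rewrite (last_below_succ hw) ?eqxx /=; lia.
Qed.

Let maxshortN j : j <= n -> rise (run v j) ->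
  forall (z : 'I_n), z.+1 = j :> nat -> maxshort d (Qkey a n v) z = false.
Proof.
move=> jn r z zj; have L := @rise_laser_end j ltac:(lia) r.
have [Lz _ _] := @laser_endP n h j hw ltac:(lia).
have xn : (laser_end n h j).-1 < n by lia.
apply/negbTE/forallPn; exists (Ordinal xn); rewrite /Qkey -/h /= zj.
by rewrite prednK ?(laser_end_idem hw) ?eqxx /=; lia.
Qed.

Let riseN0 : rise (run v 0).
Proof. by apply: contraT => /(fall_gt0 (leq0n n)). Qed.

Let fallNn : ~~ rise (run v n).
Proof. by apply/negP => /(rise_lt (leqnn n)); rewrite ltnn. Qed.

(** The labels d and n - d of the central block are below all later labels. The first keeps the
    P-blocks that start among 1, ..., d within these labels, the second keeps the noncentral
    Q-blocks that end after n - d beyond n - d; so these blocks are short. *)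
Lemma Qcentral_form : Qcentral a d v -> exists w,
  [/\ periodic w, forall i, i < n -> run v i = w i, ~~ rise (run v n)
    & S_pair d (pi_path a v) = splitw w].
Proof.
rewrite /Qcentral -/h => Ld; have [h0 hn hp _] := hw.
have Ln : laser_end n h n = n by apply: laser_end_last => //; lia.
have hd j : d < j <= n -> (h d < h j)%R.
  by have [_ _ Ly] := @laser_endP n h d hw ltac:(lia); rewrite Ld in Ly; apply: Ly.
have Lnd : laser_end n h (n - d) = n.
  have [wr _] := rotates_wrap ((pi_rotates co d (proj1 iv) (proj1 iv)).1 (proj2 iv)).2.
  by rewrite -/h Ld Ln in wr; apply: wr.
have hnd j : n - d < j <= n -> (h (n - d)%N < h j)%R.
  by have [_ _ Ly] := @laser_endP n h (n - d) hw ltac:(lia); rewrite Lnd in Ly;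
    apply: Ly.
have Mge z : d < z <= n -> d <= last_below h z.
  move=> dz; have [Mz hM My] := @last_belowP n h z hw ltac:(lia).
  by have := hd z dz; have := My d; lia.
have per i : 0 <= i -> i + d <= n.-1 -> run v (i + d) = run v i.
  move=> _ ii; case: (boolP (rise (run v i))) => r.
    by apply: rise_shift => //; [lia|apply: Mge; lia].
  by apply: fall_shift => //; [apply: fall_gt0 r|]; lia.
have vw i : i < n -> run v i = run v (i %% d).
  move=> ii; rewrite {1}(divn_eq i d) addnC.
  by apply: (periodic_runs per) => //; rewrite addnC -divn_eq; lia.
exists (fun i => run v (i %% d)); split=> //; first by move=> i; rewrite modnDr.
rewrite S_pi // /splitw; congr pair; apply/ffunP => i; rewrite !ffunE.
  have id := ltn_ord i; rewrite modn_small //; case: (boolP (rise _)) => r; last first.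
    by rewrite (minshortN id r).
  have Mi := @rise_last_below i ltac:(lia) r; rewrite [Pkey _ _ _ _]Mi ifT //.
  apply/forallP => y; apply/implyP => /eqP; rewrite [in RHS]/Pkey -/h Mi => e.
  have := Pkey_bound hw y; rewrite -/h e /= => iy; rewrite iy /=.
  case: (ltnP y.+1 d.+1) => yd; first by lia.
  have yn := ltn_ord y; have := Mge y.+1 ltac:(lia).
  by rewrite (_ : last_below h y.+1 = i) //; lia.
have id := ltn_ord i; set j := n - d + i.+1.
have jE : (hi d0 dn i).+1 = j by rewrite /j addnS.
(* The last index is the label n, the maximum of the central block; the entry of [w] at d is that at
   0, a rise. Both sides are 0. *)
have [e|/eqP e] := eqVneq i.+1 d.
  rewrite e modnn riseN0; have e2 : n - d - 1 < n by lia.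
  rewrite ifF //; apply/negbTE/forallPn; exists (Ordinal e2).
  rewrite /Qkey -/h jE /j e subnK; last by lia.
  by rewrite Ln (_ : (Ordinal e2).+1 = n - d) ?Lnd ?eqxx /=; lia.
have [q eq] := ddnd.
have vj : run v j = run v i.+1.
  by rewrite /j addnC eq; apply: (periodic_runs per) => //; rewrite -eq; lia.
rewrite modn_small -?vj; last by lia.
case: (boolP (rise _)) => r; first by rewrite (@maxshortN j) //; lia.
have Lj := @fall_laser_end j ltac:(lia) r; rewrite [Qkey _ _ _ _](_ : _ = j);
  last by rewrite /Qkey jE.
rewrite ifT //; apply/forallP => y; apply/implyP => /eqP.
rewrite {2}/Qkey -/h jE Lj => e'; have yb := Qkey_bound hw y; rewrite -/h e' in yb.
have [Ly hL _] := @laser_endP n h y.+1 hw ltac:(lia).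
have e'' : laser_end n h y.+1 = j by []; rewrite e'' in Ly hL.
case: (ltngtP y.+1 (n - d)) => yd; last 1 first.
- by rewrite yd Lnd in e''; lia.
- have [_ _ Ly'] := @laser_endP n h y.+1 hw ltac:(lia); rewrite e'' in Ly'.
  by have := Ly' (n - d); have := hnd j.+1; lia.
- by rewrite -ltnS jE; lia.
Qed.

Lemma Pcentral_form : Pcentral a d v -> exists w,
  [/\ periodic w, forall i, 0 < i <= n -> run v i = w i, rise (run v 0)
    & S_pair d (pi_path a v) = splitw w].
Proof.
rewrite /Pcentral -/h => Md; have [h0 hn hp _] := hw.
have M1 : last_below h 1 = 0 by have [] := @last_belowP n h 1 hw ltac:(lia); lia.
have left z j : last_below h z = 0 -> 0 < j < z -> z <= n -> (h z < h j)%R.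
  by move=> Mz jz zn; have [_ _ My] := @last_belowP n h z hw ltac:(lia); apply: My; lia.
have [inj rk] := rotM; rewrite -/h in inj.
have Mnd : last_below h (n - d).+1 = 0.
  have [_ wr] := rotates_wrap ((pi_rotates co d (proj1 iv) (proj1 iv)).1 (proj2 iv)).1.
  by rewrite -/h Md M1 in wr; apply: wr.
have per i : 0 < i -> i + d <= n -> run v (i + d) = run v i.
  move=> i0 ii; case: (boolP (rise (run v i))) => r; last by apply: fall_shift.
  have Mi := @rise_last_below i ltac:(lia) r.
  (* If i + d = n, then i + 1 = n - d + 1 is a label of the central P-block and has key 0, whereas
     the rise gives it the key i > 0. *)
  have id : i + d < n.
    case: (ltngtP (i + d) n) ii => // e _.
    by move: Mnd; rewrite (_ : n - d = i) ?Mi; lia.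
  apply: rise_shift => //; have [Mz hM My] := @last_belowP n h (i.+1 + d) hw ltac:(lia).
  case: (ltnP (last_below h (i.+1 + d)) d) => // H.
  case: (posnP (last_below h (i.+1 + d))) => H0.
    by have := inj i.+1 1 isT isT ltac:(lia) ltac:(lia); rewrite H0 add1n Md Mi M1; lia.
  by have := left d.+1 (last_below h (i.+1 + d)) Md; have := My d.+1; lia.
(* The period is read from v_1, ..., v_d, as v_0 is the central rank; hence d represents the residue
   0. *)
pose w i := run v (if i %% d == 0 then d else i %% d).
have wE i : 0 < i <= d -> w i = run v i.
  move=> ii; rewrite /w; have [->|/eqP e] := eqVneq i d; first by rewrite modnn.
  by rewrite modn_small ?ifF //; lia.
have wp i : w (i + d) = w i by rewrite /w modnDr.
have vw i : 0 < i <= n -> run v i = w i.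
  move=> ii; have e := divn_eq i.-1 d; have r := ltn_pmod i.-1 d0.
  have -> : i = (i.-1 %% d).+1 + i.-1 %/ d * d by lia.
  rewrite (periodic_runs per) //; last by lia.
  by rewrite (periodic_mul _ _ wp) wE.
exists w; split=> //.
have [q eq] := ddnd.
have nE : n = d + q * d by rewrite -eq; lia.
have wd : w 0 = run v n.
  rewrite (vw n); last by lia.
  by rewrite [in RHS]nE (periodic_mul _ _ wp) -(wp 0) add0n.
rewrite S_pi // /splitw; congr pair; apply/ffunP => i; rewrite !ffunE;
  have id := ltn_ord i.
  case: (posnP i) => i0.
    rewrite i0 wd (negbTE fallNn) ifF //; have dn' : d < n by lia.
    apply/negbTE/forallPn; exists (Ordinal dn'); rewrite /Pkey -/h /= i0 M1 Md.
    by rewrite eqxx /=; lia.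
  rewrite wE; last by lia.
  case: (boolP (rise _)) => r; last by rewrite (minshortN id r).
  have Mi := @rise_last_below i ltac:(lia) r; rewrite [Pkey _ _ _ _]Mi ifT //.
  apply/forallP => y; apply/implyP => /eqP; rewrite [in RHS]/Pkey -/h Mi => e.
  have := Pkey_bound hw y; rewrite -/h e /= => iy; rewrite iy /=.
  case: (ltnP y (i + d)) => yd //; have yn := ltn_ord y.
  have [My hM Myy] := @last_belowP n h y.+1 hw ltac:(lia);
    rewrite -/(Pkey a n v y) e in My hM Myy.
  by have := left d.+1 i Md; have := Myy d.+1; lia.
set j := n - d + i.+1.
have jE : (hi d0 dn i).+1 = j by rewrite /j addnS.
have vj : run v j = w i.+1.
  rewrite vw; last by lia.
  by rewrite /j addnC eq (periodic_mul _ _ wp).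
rewrite -vj; case: (boolP (rise _)) => r; first by rewrite (@maxshortN j) //; lia.
have Lj := @fall_laser_end j ltac:(lia) r; rewrite [Qkey _ _ _ _](_ : _ = j);
  last by rewrite /Qkey jE.
rewrite ifT //; apply/forallP => y; apply/implyP => /eqP.
rewrite {2}/Qkey -/h jE Lj => e'; have yb := Qkey_bound hw y; rewrite -/h e' in yb.
have [Ly hL Lyy] := @laser_endP n h y.+1 hw ltac:(lia).
have e'' : laser_end n h y.+1 = j by []; rewrite e'' in Ly hL Lyy.
case: (ltnP y.+1 (n - d).+1) => yd; last by rewrite -ltnS jE; lia.
by have := left (n - d).+1 y.+1 Mnd; have := Lyy (n - d).+1; lia.
Qed.
End Form.
End CentralForm.

(** * Good sequence pairs *)

Section Weights.
Variables (a n d : nat).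
Hypotheses (co : coprime a n.+1) (d0 : 0 < d) (dn : 2 * d <= n) (ddn : d %| n).
Implicit Types (w : nat -> nat) (s : nseqs d * nseqs d).

Lemma periodic_eqmod w i j : periodic d w -> i = j %[mod d] -> w i = w j.
Proof. by move=> pw e; rewrite -(periodic_modn i pw) e periodic_modn. Qed.

Lemma periodic_shift w c : periodic d w -> periodic d (fun i => w (i + c)).
Proof. by move=> pw i; rewrite addnAC pw. Qed.

Lemma riseP (c : nat) : reflect (slope a n.+1 < c%:R)%R (rise a n c).
Proof. by rewrite slope_lt /rise; apply: (iffP idP); lia. Qed.

Lemma rise_neq (c : nat) : n.+1 * c <> a.
Proof.
by move=> e; have := co; rewrite -e /coprime gcdnC gcdnMr; lia.
Qed.

Lemma fallP (c : nat) : reflect (c%:R < slope a n.+1)%R (~~ rise a n c).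
Proof.
by have ne := @rise_neq c; rewrite slope_gt /rise -leqNgt; apply: (iffP idP); lia.
Qed.

(** If an entry rises in only one of the two weights, the equations for p and for q force both
    values to be 0. *)
Lemma splitw_inj w w' : periodic d w -> periodic d w' ->
  splitw a n d w = splitw a n d w' -> w =1 w'.
Proof.
move=> pw pw' [/ffunP e1 /ffunP e2] i.
rewrite -(periodic_modn i pw) -(periodic_modn i pw').
have id := ltn_pmod i d0; move: (i %% d) id => {}i id.
have d1 : d.-1 < d by lia.
have [j ej] : exists j : 'I_d, w j.+1 = w i /\ w' j.+1 = w' i.
  case: i id => [|i] id; last by exists (Ordinal (ltnW id)).
  by exists (Ordinal d1);
    rewrite /= prednK // -[d in w d]add0n -[d in w' d]add0n pw pw'.
have := e1 (Ordinal id); have := e2 j; rewrite !ffunE /= ej.1 ej.2.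
have r0 : rise a n 0 = false by rewrite /rise muln0.
do 2!case: ifP => //; move=> r r' // A B.
  by rewrite -A B.
by rewrite -B A.
Qed.

(** A cyclic shift moves the weights back by one index, which modulo d is forward by d - 1. *)
Lemma shift_splitw w t : periodic d w ->
  iter t (@shift_pair d) (splitw a n d w) = splitw a n d (fun i => w (i + t * d.-1)).
Proof.
move=> pw; elim: t => [|t IH].
  by congr pair; apply/ffunP => i; rewrite !ffunE /= !addn0.
have pw' := periodic_shift (t * d.-1) pw.
rewrite iterS IH /shift_pair; congr pair; apply/ffunP => i; rewrite !ffunE /=.
  have -> : w ((i + d).-1 %% d + t * d.-1) = w (i + t.+1 * d.-1) => //.
  rewrite (periodic_modn _ pw'); congr w; rewrite mulSn; lia.
have -> : w (((i + d).-1 %% d).+1 + t * d.-1) = w (i.+1 + t.+1 * d.-1) => //.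
apply: (periodic_eqmod pw); apply/eqP.
rewrite mulSn addnA eqn_modDr -addn1 modnDml; apply/eqP; congr (_ %% _); lia.
Qed.

Lemma sum_periodic w k : periodic d w -> \sum_(i < k * d) w i = k * \sum_(i < d) w i.
Proof.
move=> pw; elim: k => [|k IH]; first by rewrite !mul0n big_ord0.
rewrite !mulSn addnC big_split_ord /= IH addnC; congr (_ + _).
by apply: eq_bigr => i _; rewrite addnC periodic_mul.
Qed.

Lemma sum_shift w c : periodic d w -> \sum_(i < d) w (i + c) = \sum_(i < d) w i.
Proof.
move=> pw; elim: c => [|c IH]; first by apply: eq_bigr => i _; rewrite addn0.
rewrite -IH; clear co dn ddn; case: (d) d0 pw => // e _ pw;
  rewrite big_ord_recr [RHS]big_ord_recl /= addnC.
congr (_ + _); first by rewrite -[RHS]pw; congr w; rewrite /=; lia.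
by apply: eq_bigr => i _; congr w; rewrite /bump; lia.
Qed.

Lemma sum_splitw w : periodic d w ->
  \sum_(i < d) ((splitw a n d w).1 i + (splitw a n d w).2 i) = \sum_(i < d) w i.
Proof.
move=> pw; rewrite big_split /=.
under eq_bigr do rewrite ffunE; under [X in _ + X]eq_bigr do rewrite ffunE.
pose w2 i := if rise a n (w i) then 0 else w i.
have p2 : periodic d w2 by move=> i; rewrite /w2 pw.
have -> : \sum_(i < d) (if rise a n (w i.+1) then 0 else w i.+1) = \sum_(i < d) w2 i.
  by rewrite -(sum_shift 1 p2); apply: eq_bigr => i _; rewrite addn1.
by rewrite -big_split; apply: eq_bigr => i _; rewrite /w2 /=; case: ifP; rewrite ?addn0.
Qed.

Lemma weight_le (x : nat) : (x%:R <= (a * d)%:R / (n.+1%:R - 1) :> rat)%R = (n * x <=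
  a * d).
Proof.
by rewrite -natr1 addrK ler_pdivlMr ?ltr0n -?natrM ?ler_nat 1?mulnC //; lia.
Qed.

Lemma good_splitw w : periodic d w -> n * \sum_(i < d) w i <= a * d ->
  good_pair a n.+1 (splitw a n d w).
Proof.
move=> pw sw; split=> [i|i||[i [/=]]].
- rewrite ffunE; case: ifP => [/riseP|]; [by right|by left].
- rewrite ffunE; case: ifPn => [_|/fallP //].
  by apply/fallP; rewrite /rise muln0.
- by rewrite sum_splitw // weight_le.
- rewrite !ffunE /= (periodic_modn _ pw); by case: ifP.
Qed.

Lemma good_form s : good_pair a n.+1 s -> exists w,
  [/\ periodic d w, n * \sum_(i < d) w i <= a * d & s = splitw a n d w].
Proof.
move=> [g1 g2 g3 g4].
pose p i := s.1 (Ordinal (ltn_pmod i d0)); pose q i := s.2 (Ordinal (ltn_pmod i d0)).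
have pE i j : i = j %[mod d] -> p i = p j by move=> e; congr (s.1 _); apply: val_inj.
have qE i j : i = j %[mod d] -> q i = q j by move=> e; congr (s.2 _); apply: val_inj.
(* i + (d - 1) is the predecessor of i modulo d; by the last condition on good pairs at most one
   summand is nonzero. *)
pose w i := p i + q (i + d.-1).
have pw : periodic d w.
  by move=> i; rewrite /w (pE _ i) ?modnDr // (qE _ (i + d.-1)) // addnAC modnDr.
have pq i : q i <> 0 -> p i.+1 = 0.
  move=> qi; apply/eqP; apply: contraT => /eqP pi; case: g4.
  exists (Ordinal (ltn_pmod i d0)); split=> //; rewrite /p in pi.
  move=> H; apply: pi; rewrite -[RHS]H; congr (s.1 _); apply: val_inj => /=.
  by rewrite -addn1 -(addn1 (i %% d)) modnDml.
have pv (i : 'I_d) : p i = s.1 i by congr (s.1 _); apply: val_inj;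
  rewrite /= modn_small.
have qv (i : 'I_d) : q i = s.2 i by congr (s.2 _); apply: val_inj;
  rewrite /= modn_small.
have wS i : w i.+1 = p i.+1 + q i.
  by congr (_ + _); apply: qE; rewrite addSn -addnS prednK // modnDr.
have sE : s = splitw a n d w.
  rewrite [LHS]surjective_pairing; congr pair; apply/ffunP => i; rewrite ffunE.
    have -> : w i = p (i + d.-1).+1 + q (i + d.-1).
      by rewrite /w; congr (_ + _); apply: pE; rewrite -addnS prednK // modnDr.
    have qf : ~~ rise a n (q (i + d.-1)) by apply/fallP/g2.
    have e : p (i + d.-1).+1 = s.1 i.
      by rewrite -pv; apply: pE; rewrite -addnS prednK // modnDr.
    have [q0|/eqP/pq p0] := eqVneq (q (i + d.-1)) 0; last first.
      by rewrite -e p0 add0n (negbTE qf).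
    rewrite q0 addn0 e; case: ifPn => // nr.
    by case: (g1 i) => [->//|/riseP]; rewrite (negbTE nr).
  rewrite wS qv; case: ifPn => r.
    apply/eqP; apply: contraT => /eqP q0.
    by rewrite pq ?qv // add0n in r; have /fallP := g2 i; rewrite r.
  have [q0|/eqP q0] := eqVneq (s.2 i) 0; last by rewrite pq ?qv.
  rewrite q0 addn0 in r *; rewrite /p in r *.
  by case: (g1 (Ordinal (ltn_pmod i.+1 d0))) => [->//|/riseP]; rewrite (negbTE r).
exists w; split=> //.
by move: g3; rewrite sE sum_splitw // weight_le.
Qed.
End Weights.

(** * Bijectivity *)

Section Main.
Variables (a n d : nat).
Hypotheses (co : coprime a n.+1) (d0 : 0 < d) (dn : 2 * d <= n) (ddn : d %| n).
Implicit Types (w : nat -> nat) (v : n.+1.-tuple nat) (PQ : ranked n.+1 * ranked n.+1).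

Let n0 : 0 < n. Proof. by clear co ddn; lia. Qed.

Lemma level_add w c i :
  level a n w (i + c) = (level a n w c + level a n (fun j => w (j + c)) i)%R.
Proof.
elim: i => [|i IH]; first by rewrite level0 add0n addr0.
by rewrite addSn !levelS IH /= !addrA.
Qed.

Lemma level_periodic w i q : periodic d w ->
  level a n w (i + q * d) = (level a n w i + q%:Z * level a n w d)%R.
Proof.
move=> pw; elim: q => [|q IH]; first by rewrite mul0n addn0 mul0r addr0.
have -> : i + q.+1 * d = (i + q * d) + d by rewrite mulSn; lia.
rewrite level_add (@eq_level a n _ w) ?IH; last by move=> j _; apply: pw.
by rewrite -addn1 PoszD; ring.
Qed.

Lemma level_addn w i : periodic d w ->
  level a n w (i + n) = (level a n w i + level a n w n)%R.
Proof.
move=> pw; have /dvdnP[k ek] := ddn.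
have H j : level a n w (j + n) = (level a n w j + k%:Z * level a n w d)%R.
  by have -> : j + n = j + k * d by [rewrite -ek]; exact: level_periodic.
by have := H 0; rewrite add0n level0 add0r => ->; exact: H.
Qed.

Lemma sum_n_shift w c : periodic d w -> \sum_(i < n) w (i + c) = \sum_(i < n) w i.
Proof.
move=> pw; apply: (sum_shift n0) => i; have /dvdnP[k ->] := ddn.
exact: periodic_mul.
Qed.

(** Taken over n/d periods, the bound on one period says that the central rank is nonnegative. *)
Lemma sum_n_le w : periodic d w ->
  (n * \sum_(i < d) w i <= a * d) = (\sum_(i < n) w i <= a).
Proof.
move=> pw; have -> : n * \sum_(i < d) w i = d * \sum_(i < n) w i; last first.
  by rewrite mulnC leq_pmul2r.
by have /dvdnP[k ->] := ddn; rewrite sum_periodic // mulnCA mulnA.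
Qed.

Lemma dyck_sum v : dyck a v -> \sum_(i < n.+1) run v i = a.
Proof.
move=> /dyckP[e _]; move: e; rewrite /level.
have -> (x : nat) : (n.+1%:Z * x%:Z - a%:Z * n.+1%:Z = n.+1%:Z * (x%:Z - a%:Z))%R by
  ring.
by move=> /eqP; rewrite mulf_eq0 /= subr_eq0 => /eqP[].
Qed.

(* Both kinds of central paths are determined by the weights w: a Q-central
   path ends, and a P-central path starts, with the rank of the central block. *)
Definition central_path v w : Prop :=
  (Qcentral a d v /\ (forall i, i < n -> run v i = w i) /\ ~~ rise a n (run v n)) \/
  (Pcentral a d v /\ (forall i, 0 < i <= n -> run v i = w i) /\ rise a n (run v 0)).

(** The periodic entries and the end entry add up to a, so [w] alone determines the end entry and,
    by its comparison with a/b, the kind of the path. *)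
Lemma central_rank v w : dyck a v -> periodic d w -> central_path v w ->
  \sum_(i < n) w i <= a /\
  (if rise a n (a - \sum_(i < n) w i)
   then run v 0 = a - \sum_(i < n) w i /\ Pcentral a d v /\
        (forall i, 0 < i <= n -> run v i = w i)
   else run v n = a - \sum_(i < n) w i /\ Qcentral a d v /\
        (forall i, i < n -> run v i = w i)).
Proof.
move=> dv pw; have := dyck_sum dv => e [[cv [vw r]]|[cv [vw r]]].
  have e' : \sum_(i < n) w i + run v n = a.
    by rewrite -e big_ord_recr; congr addn; apply: eq_bigr => i _; rewrite -vw.
  have er : run v n = a - \sum_(i < n) w i by rewrite -e' addKn.
  by rewrite -er (negbTE r); split=> //; rewrite -e' leq_addr.
have e' : run v 0 + \sum_(i < n) w i = a.
  rewrite -e big_ord_recl -(sum_n_shift 1 pw); congr addn.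
  by apply: eq_bigr => i _; rewrite addn1 -vw // /= ltn_ord.
have er : run v 0 = a - \sum_(i < n) w i by rewrite -e' addnK.
by rewrite -er r; split=> //; rewrite -e' leq_addl.
Qed.

Lemma central_path_inj v v' w : dyck a v -> dyck a v' -> periodic d w ->
  central_path v w -> central_path v' w -> v = v'.
Proof.
move=> dv dv' pw /(central_rank dv pw)[_ +] /(central_rank dv' pw)[_].
have run_inj : (forall i, i <= n -> run v i = run v' i) -> v = v'.
  move=> e; apply: eq_from_tnth => i.
  by rewrite !(tnth_nth 0); apply: e; rewrite -ltnS.
case: ifP => _ [e' [_ vw']] [e [_ vw]]; apply: run_inj => i ii.
  by case: (posnP i) => [->|i0]; rewrite ?e ?e' ?vw ?vw' ?i0.
have [->|ni] := eqVneq i n; first by rewrite e e'.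
by rewrite vw ?vw' //; lia.
Qed.

Lemma central_form v : invpath a d v -> Qcentral a d v \/ Pcentral a d v ->
  exists w, [/\ periodic d w, central_path v w
              & S_pair d (pi_path a v) = splitw a n d w].
Proof.
move=> iv [c|c].
  by have [w [pw vw r S]] := Qcentral_form co d0 dn ddn iv c; exists w; split=> //;
    left.
by have [w [pw vw r S]] := Pcentral_form co d0 dn ddn iv c; exists w; split=> //; right.
Qed.

Lemma NCd_form PQ : NCd a d PQ -> exists t (v : n.+1.-tuple nat) w,
  [/\ invpath a d v, pi_path a v = iter t (@rot_pair n.+1) PQ, periodic d w,
      central_path v w & S_pair d (pi_path a v) = splitw a n d w].
Proof.
move=> /NCdP[u iu ->]; have [t [v [iv e c]]] := exists_rot_central co d0 dn ddn iu.
by have [w [pw cv S]] := central_form iv c; exists t, v, w.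
Qed.

Lemma iter_rot_mul PQ k : NCd a d PQ -> iter (k * d) (@rot_pair n.+1) PQ = PQ.
Proof. by move=> [_ e]; elim: k => // k IH; rewrite mulSn addnC iterD e. Qed.

Lemma iter_rot_unrot PQ t : NCd a d PQ ->
  iter (t * d.-1) (@rot_pair n.+1) (iter t (@rot_pair n.+1) PQ) = PQ.
Proof.
by move=> H; rewrite -iterD -mulnSr prednK // iter_rot_mul.
Qed.

Lemma S_good PQ : NCd a d PQ -> good_pair a n.+1 (S_pair d PQ).
Proof.
move=> H; have [t [v [w [iv e pw cv S]]]] := NCd_form H.
rewrite -(iter_rot_unrot t H) -e (S_rots co d0 dn ddn); last first.
  by rewrite e; apply: (NC_rot co d0 dn).
rewrite S shift_splitw //; apply: good_splitw => //; first exact: periodic_shift.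
by rewrite sum_shift // sum_n_le //; have [] := central_rank (proj1 iv) pw cv.
Qed.

Lemma argmin (F : nat -> int) : exists2 u, u < d & forall j, j < d -> (F u <= F j)%R.
Proof.
elim: (d) d0 => // -[|e] IH _; first by exists 0 => // -[].
have [u ue hu] := IH isT; case: (lerP (F u) (F e.+1)) => c.
  by exists u => [|j]; [lia|rewrite ltnS leq_eqVlt => /orP[/eqP->|/hu]].
exists e.+1 => // j; rewrite ltnS leq_eqVlt => /orP[/eqP->//|/hu]; lia.
Qed.

(* Cycle lemma: start the period where its walk is minimal. *)
Lemma central_path_exists w : periodic d w -> \sum_(i < n) w i <= a ->
  exists t (v : n.+1.-tuple nat),
    invpath a d v /\ central_path v (fun i => w (i + t)).
Proof.
move=> pw sw; set r := a - \sum_(i < n) w i.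
have /dvdnP[k ek] := ddn.
have k0 : 0 < k by case: k ek; lia.
have wn : level a n w n = (a%:Z - n.+1%:Z * r%:Z)%R.
  rewrite /level /r -subzn //; ring.
have wkd : level a n w n = (k%:Z * level a n w d)%R.
  have := level_periodic 0 k pw; rewrite add0n -ek level0 add0r.
  by move=> ->.
have dec t : t < k.+1 * d -> exists i q, [/\ i < d, q <= k & t = i + q * d].
  move=> tk; exists (t %% d), (t %/ d); rewrite ltn_pmod // addnC -divn_eq; split=> //.
  by rewrite -ltnS ltn_divLR.
case: (boolP (rise a n r)) => rr; last first.
  (* With r below a/b, a full turn of [w] ends at level a - (n + 1) r > 0; the weights climb, and r
     closes the path at its end. *)
  have D0 : (0 < level a n w d)%R.
    have ne : n.+1 * r <> a by apply: (rise_neq co d0 dn ddn).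
    have : (0 < level a n w n)%R by rewrite wn; move: rr; rewrite /rise; lia.
    by rewrite wkd pmulr_rgt0.
  have [u ud hu] := argmin (level a n w); exists u.
  pose f i := if i == n then r else w (i + u).
  have pf := periodic_shift u pw.
  have fE i : i <= n -> level a n f i = (level a n w (i + u) - level a n w u)%R.
    move=> ii; rewrite level_add (@eq_level a n f (fun j => w (j + u)));
      first by rewrite addrAC subrr add0r.
    by move=> j ji; rewrite /f ifF //; lia.
  have fn : level a n f n.+1 = 0%R.
    by rewrite levelS fE // addnC level_addn // wn /f eqxx; lia.
  pose v := [tuple f i | i < n.+1].
  have dv : dyck a v.
    apply: dyck_mktuple => // i ii; rewrite fE; last by lia.
    have [j [q [jd qk ->]]] := dec (i + u) ltac:(rewrite mulSn -ek; lia).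
    have qD : (0 <= q%:Z * level a n w d)%R by apply: mulr_ge0 => //; exact: ltW.
    by rewrite level_periodic //; have := hu j jd; lia.
  have vw i : i < n -> run v i = w (i + u).
    by move=> ii; rewrite run_mktuple /f ?ifF //; lia.
  have [iv cv] := Qperiodic_inv co d0 dn ddn dv pf vw.
  exists v; split=> //; left; split=> //; split=> //.
  by rewrite run_mktuple // /f eqxx.
(* Now a full turn descends by (n + 1) r - a, and r, put in front, lifts the path by exactly this
   amount. As r takes index 0, the period starts at u + 1, whence the minimum over shifted
   levels. *)
have D0 : (level a n w d < 0)%R.
  have : (level a n w n < 0)%R by rewrite wn; move: rr; rewrite /rise; lia.
  by rewrite wkd pmulr_rlt0.
have [u ud hu] := argmin (fun i => level a n w i.+1); exists u.
pose f i := if i == 0 then r else w (i + u).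
have pf := periodic_shift u pw.
have fE i : level a n f i.+1 = (n.+1%:Z * r%:Z - a%:Z + level a n w (i.+1 + u) -
  level a n w u.+1)%R.
  elim: i => [|i IH]; first by rewrite levelS level0 /f /= add1n; lia.
  rewrite [LHS]levelS IH addSn [level a n w (i.+1 + u).+1]levelS.
  by have -> : f i.+1 = w (i.+1 + u) by []; ring.
have fn : level a n f n.+1 = 0%R.
  by rewrite fE addSnnS addnC level_addn // wn; lia.
pose v := [tuple f i | i < n.+1].
have dv : dyck a v.
  apply: dyck_mktuple => // -[//|i] ii; rewrite fE.
  have [j [q [jd qk e]]] := dec (i + u) ltac:(rewrite mulSn -ek; lia).
  rewrite addSn e -addSn level_periodic //; have := hu j jd.
  have : (k%:Z * level a n w d <= q%:Z * level a n w d)%R by apply: ler_wnM2r;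
    [exact: ltW|rewrite lez_nat].
  by rewrite -wkd wn; lia.
have vw i : 0 < i <= n -> run v i = w (i + u).
  by move=> ii; rewrite run_mktuple /f ?ifF //; lia.
have [iv cv] := Pperiodic_inv co d0 dn ddn dv pf vw.
exists v; split=> //; right; split=> //; split=> //.
by rewrite run_mktuple.
Qed.

Lemma central_path_S v w : invpath a d v -> periodic d w -> central_path v w ->
  S_pair d (pi_path a v) = splitw a n d w.
Proof.
move=> iv pw [[c [vw _]]|[c [vw _]]].
  have [w' [pw' vw' _ ->]] := Qcentral_form co d0 dn ddn iv c.
  suff e : w' =1 w by congr pair; apply/ffunP => i; rewrite !ffunE !e.
  move=> i; rewrite -(periodic_modn i pw) -(periodic_modn i pw').
  by have := ltn_pmod i d0 => H; rewrite -vw -?vw'; lia.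
have [w' [pw' vw' _ ->]] := Pcentral_form co d0 dn ddn iv c.
suff e : w' =1 w by congr pair; apply/ffunP => i; rewrite !ffunE !e.
move=> i; rewrite -(periodic_modn i pw) -(periodic_modn i pw') -pw -pw'.
by have := ltn_pmod i d0 => H; rewrite -vw -?vw'; lia.
Qed.

Lemma S_surj s : good_pair a n.+1 s ->
  exists2 PQ : ranked n.+1 * ranked n.+1, NCd a d PQ & S_pair d PQ = s.
Proof.
move=> g; have [w [pw sw ->]] := good_form co d0 dn ddn g.
rewrite sum_n_le // in sw; have [t [v [iv cv]]] := central_path_exists pw sw.
have H : NCd a d (pi_path a v) by case: iv => dv e; split; first by exists v.
(* The weights of v are [w] advanced by t; t rotations advance them by t (d - 1) more, in all by a
   multiple of d. *)
exists (iter t (@rot_pair n.+1) (pi_path a v)); first exact: (NC_rot co d0 dn).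
rewrite (S_rots co d0 dn ddn) // (central_path_S iv _ cv); last exact: periodic_shift.
rewrite (shift_splitw co d0 dn ddn); last exact: periodic_shift.
congr pair; apply/ffunP => i; rewrite !ffunE.
  by rewrite -addnA -mulnSr prednK // periodic_mul.
by rewrite -addnA -mulnSr prednK // periodic_mul.
Qed.

Section RotateCentral.
Variables (v v' : n.+1.-tuple nat) (t : nat).
Hypotheses (iv : invpath a d v) (iv' : invpath a d v').
Hypothesis e : pi_path a v' = iter t (@rot_pair n.+1) (pi_path a v).

Let hw : walk n (level a n (run v)). Proof. by apply: dyck_walk; last case: iv. Qed.
Let hw' : walk n (level a n (run v')). Proof. by apply: dyck_walk; last case: iv'. Qed.

Let rdC (z : 'I_n) : rd t (rd d z) = rd d (rd t z).
Proof. by rewrite !rd_add addnC. Qed.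

(** The two rotations commute, so the fact that y and its image under rot^d share a block of v
    carries over to n and d in v'. *)
Lemma rot_Qcentral (y : 'I_n) : Qcentral a d v ->
  rd t y = n.-1 :> nat -> Qkey a n v y = n -> Qcentral a d v'.
Proof.
move=> cv ty ky; have [dv ev] := iv; have [dv' _] := iv'.
have [_ [r _]] := (pi_rotates co t dv dv').1 (esym e).
have [_ [s _]] := (pi_rotates co d dv dv).1 ev.
have dl : d.-1 < n by clear ddn; lia.
have rdm (z : 'I_n) : z = n.-1 :> nat -> rd d z = Ordinal dl.
  move=> zn; apply: ord_inj; rewrite val_rd_small ?zn /=; last by lia.
  by case: ifP; lia.
have kd : Qkey a n v (Ordinal dl) = n by rewrite /Qkey /= prednK.
have nl : n.-1 < n by lia.
have kl (u : n.+1.-tuple nat) (z : 'I_n) : walk n (level a n (run u)) ->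
    z = n.-1 :> nat -> Qkey a n u z = n.
  by move=> wu zn; rewrite /Qkey zn prednK // laser_end_last.
have e1 : Qkey a n v (rd d y) = Qkey a n v (rd d (Ordinal nl)).
  by apply/eqP; rewrite s ky kl.
have /eqP : Qkey a n v (rd d y) = Qkey a n v y by rewrite e1 rdm // kd ky.
rewrite -r rdC (rdm _ ty) => /eqP.
by rewrite (kl _ _ hw' ty) /Qkey /= prednK.
Qed.

Lemma rot_Pcentral (y : 'I_n) : Pcentral a d v ->
  rd t y = 0 :> nat -> Pkey a n v y = 0 -> Pcentral a d v'.
Proof.
move=> cv ty ky; have [dv ev] := iv; have [dv' _] := iv'.
have [[r _] _] := (pi_rotates co t dv dv').1 (esym e).
have [[s _] _] := (pi_rotates co d dv dv).1 ev.
have dl : d < n by clear ddn; lia.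
have rdm (z : 'I_n) : z = 0 :> nat -> rd d z = Ordinal dl.
  move=> zn; apply: ord_inj; rewrite val_rd_small ?zn /=; last by lia.
  by case: ifP; lia.
have kl (u : n.+1.-tuple nat) (z : 'I_n) : walk n (level a n (run u)) ->
    z = 0 :> nat -> Pkey a n u z = 0.
  by move=> wu zn; have := Pkey_bound wu z; lia.
have e1 : Pkey a n v (rd d y) = Pkey a n v (rd d (Ordinal n0)).
  by apply/eqP; rewrite s ky kl.
have /eqP : Pkey a n v (rd d y) = Pkey a n v y by rewrite e1 rdm // ky.
rewrite -r rdC (rdm _ ty) => /eqP.
by rewrite (kl _ _ hw' ty).
Qed.
End RotateCentral.

Lemma eq_central_path v w w' : w =1 w' -> central_path v w -> central_path v w'.
Proof.
by move=> e [[c [vw r]]|[c [vw r]]]; [left|right]; split=> //; split=> // i ii;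
  rewrite -e vw.
Qed.

(** Positivity of the heights of v' shows that the label u (for Q) or u + 1 (for P) is in the
    central block of v. Rotation by n - u brings it to n or 1, giving a central path with the
    weights of v'; [central_path_inj] then identifies the two. *)
Lemma central_path_rot v v' w u : invpath a d v -> invpath a d v' -> periodic d w ->
  central_path v w -> central_path v' (fun i => w (i + u)) -> 0 < u <= d ->
  pi_path a v' = iter (n - u) (@rot_pair n.+1) (pi_path a v).
Proof.
move=> iv iv' pw cv cv' ud; have pwu := periodic_shift u pw.
have [v2 iv2 e2] := invpath_rot co d0 dn (n - u) iv.
have [dv _] := iv; have [dv' _] := iv'; have [dv2 _] := iv2.
have hw := dyck_walk co dv; have hw' := dyck_walk co dv'.
have un : u < n by clear ddn; lia.
suff c2 : Qcentral a d v2 \/ Pcentral a d v2.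
  have [w2 [pw2 cv2 S2]] := central_form iv2 c2.
  rewrite -e2; congr pi_path.
  apply: (central_path_inj dv' dv2 pwu cv'); apply: eq_central_path cv2.
  have H : NCd a d (pi_path a v) by case: iv => _ ev; split; first by exists v.
  have pw3 := periodic_shift ((n - u) * d.-1) pw.
  apply: ftrans (_ : _ =1 (fun i => w (i + (n - u) * d.-1))) _.
    apply: (splitw_inj co d0 dn ddn pw2 pw3); rewrite -S2 e2 (S_rots co d0 dn ddn) //.
    by rewrite (central_path_S iv pw cv) (shift_splitw co d0 dn ddn).
  move=> i; have /dvdnP[k ek] := ddn.
  rewrite -(periodic_mul _ k pw) -ek -(periodic_mul (i + u) (n - u) pw).
  congr w; have := mulnSr (n - u) d.-1; rewrite prednK //; lia.
have [_] := central_rank dv pw cv; have [_] := central_rank dv' pwu cv'.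
rewrite (sum_n_shift u pw); case: ifP => _ [r' [c' vw']] [r [c vw]]; last first.
  left; have yn : u.-1 < n by lia.
  apply: (rot_Qcentral iv iv2 e2 (y := Ordinal yn) c).
    by rewrite val_rd_small /=; [case: ifP|]; lia.
  rewrite /Qkey /= prednK; last by lia.
  have hE i : i <= n -> level a n (run v) i = level a n w i.
    by move=> ii; apply: eq_level => j ji; apply: vw; lia.
  have hE' i : i <= n -> level a n (run v') i = level a n (fun j => w (j + u)) i.
    by move=> ii; apply: eq_level => j ji; apply: vw'; lia.
  have [_ hn hp _] := hw; have [_ _ hp' _] := hw'.
  apply: (laser_end_eq hw); try lia; first by rewrite hn; apply: hp; lia.
  move=> y yu; rewrite !hE; try lia.
  rewrite -(@subnK u y); last by lia.
  by rewrite level_add -hE'; [have := hp' (y - u)|]; lia.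
right; apply: (rot_Pcentral iv iv2 e2 (y := Ordinal un) c).
  by rewrite val_rd_small /=; [case: ifP|]; lia.
rewrite /Pkey /=; set h := level a n (run v) in hw *;
  set h' := level a n (run v') in hw' *.
have hE i : i <= n -> h i.+1 = (h 1 + level a n w i.+1 - level a n w 1)%R.
  elim: i => [|i IH] ii; first by ring.
  rewrite [LHS]levelS -/(h _) IH; last by lia.
  by rewrite [level a n w i.+2]levelS vw; [ring|lia].
have hE' i : i <= n ->
  h' i.+1 = (h' 1 + level a n w (i.+1 + u) - level a n w (1 + u))%R.
  elim: i => [|i IH] ii; first by ring.
  rewrite [LHS]levelS -/(h' _) IH; last by lia.
  by rewrite [in RHS]addSn [level a n w (i.+1 + u).+1]levelS vw'; [ring|lia].
have [h0 hn hp _] := hw; have [_ hn' hp' _] := hw'.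
(* The heights [h'] are positive up to n and return to 0 at n + 1; read modulo n, their last stretch
   describes the first labels of v. *)
have low j : 0 < j <= u -> (h u.+1 < h j)%R.
  case: j => // j ju; rewrite (hE u ltac:(lia)) (hE j ltac:(lia)).
  have := hE' (n - u + j) ltac:(lia); have := hp' (n - u + j).+1 ltac:(lia).
  have := hE' n ltac:(lia); rewrite hn'.
  have -> : n.+1 + u = u.+1 + n by lia.
  have -> : (n - u + j).+1 + u = j.+1 + n by lia.
  by rewrite !level_addn //; lia.
apply: (last_below_eq hw); rewrite ?h0; try lia; first by apply: hp; lia.
by move=> y yu; apply: low; lia.
Qed.

Lemma S_inj PQ PQ' : NCd a d PQ -> NCd a d PQ' -> S_pair d PQ = S_pair d PQ' ->
  PQ = PQ'.
Proof.
move=> H H' eS; have [t [v [w [iv ev pw cv Sv]]]] := NCd_form H.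
set PQ1 := iter t (@rot_pair n.+1) PQ'.
have H1 : NCd a d PQ1 by apply: (NC_rot co d0 dn).
(* The rotation t was chosen for [PQ], so [PQ1] need not come from a central path; it is rotated
   further, by t', to v'. *)
suff e1 : pi_path a v = PQ1.
  by rewrite -(iter_rot_unrot t H) -ev e1 iter_rot_unrot.
have S1 : S_pair d PQ1 = splitw a n d w.
  by rewrite -Sv ev !(S_rots co d0 dn ddn) // eS.
have [t' [v' [w' [iv' ev' pw' cv' Sv']]]] := NCd_form H1.
(* u represents -t' modulo d and is taken in 1, ..., d, since [central_path_rot] needs it to be
   positive. *)
pose u := d - t' %% d; have td := ltn_pmod t' d0.
have ud : 0 < u <= d by rewrite /u; lia.
have tu : t' + u = (t' %/ d).+1 * d by rewrite /u {1}(divn_eq t' d) mulSn; lia.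
have cu : central_path v' (fun i => w (i + u)).
  apply: eq_central_path cv'; have pw3 := periodic_shift (t' * d.-1) pw.
  apply: ftrans (_ : _ =1 (fun i => w (i + t' * d.-1))) _.
    apply: (splitw_inj co d0 dn ddn pw' pw3); rewrite -Sv' ev' (S_rots co d0 dn ddn) //.
    by rewrite S1 (shift_splitw co d0 dn ddn).
  move=> i; rewrite -(periodic_mul _ (t' %/ d).+1 pw) -tu -(periodic_mul (i + u) t' pw).
  by congr w; have := mulnSr t' d.-1; rewrite prednK //; lia.
have := central_path_rot iv iv' pw cv cu ud; rewrite ev' => e.
have Hv : NCd a d (pi_path a v) by rewrite ev; apply: (NC_rot co d0 dn).
have en : iter n (@rot_pair n.+1) (pi_path a v) = pi_path a v.
  by have /dvdnP[k ek] := ddn; have := iter_rot_mul k Hv; rewrite -ek.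
rewrite -(iter_rot_mul (t' %/ d).+1 H1) -tu addnC iterD e -iterD subnKC ?en //.
by clear ddn; lia.
Qed.
End Main.

Theorem theorem5p8 (a b d : nat) (ha : (0 < a)%N) (hb : (0 < b)%N)
    (hab : coprime a b) (hd0 : (1 <= d)%N) (hdb : (d < b - 1)%N)
    (hd : (d %| b - 1)%N) :
  [/\ forall PQ : ranked b * ranked b,
        NCd a d PQ -> good_pair a b (S_pair d PQ),
      forall PQ PQ' : ranked b * ranked b, NCd a d PQ -> NCd a d PQ' ->
        S_pair d PQ = S_pair d PQ' -> PQ = PQ',
      forall s : nseqs d * nseqs d, good_pair a b s ->
        exists2 PQ : ranked b * ranked b, NCd a d PQ & S_pair d PQ = s
    & forall PQ : ranked b * ranked b, NCd a d PQ ->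
        S_pair d (rot_pair PQ) = shift_pair (S_pair d PQ)].
Proof.
case: b hb hab hdb hd => // n _ co; rewrite subn1 /= => dn ddn.
have dn2 : 2 * d <= n.
  have /dvdnP[k ek] := ddn; rewrite ek leq_pmul2r //.
  by move: dn; rewrite ek -{1}[d]mul1n ltn_pmul2r.
split.
- exact: S_good.
- exact: S_inj.
- exact: S_surj.
- exact: S_rot.
Qed.
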